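(* Let $k\ge2$, let $r_{ij}=r_{ji}$ ($1\le i\ne j\le k$) be positive integers, let $\Pi(r_{12},\dots,r_{k-1\,k})$ be the Gale dual type-A root polytope, and let $r_i=\sum_{j\ne i}r_{ij}$. For a subset $\lambda\subset\{1,\dots,k\}$ let $\Pi(r_{ij\in\lambda})$ be the Gale dual root polytope corresponding to the root system $A_{|\lambda|-1}$ defined by the sequence of vectors $\alpha_{ij}$, $i\neq j\in\lambda$, with $\alpha_{ij}$ repeated $r_{ij}$ times. Then $$h(\Pi(r_{12},\dots,r_{k-1\,k}),t)=\prod_{i=1}^k(1+t+\dots+t^{r_i-1})-\sum_{\substack{(\lambda_1,\dots,\lambda_p)\vdash\{1,\dots,k\}\\ p\ge2,\ |\lambda_m|\ge2}}t^{\sum\limits_{m<n}\sum\limits_{i\in\lambda_m}\sum\limits_{j\in\lambda_n}r_{ij}}\ \prod_{m=1}^p h(\Pi(r_{ij\in\lambda_m}),t),$$ where the sum is over the (unordered) set partitions $(\lambda_1,\dots,\lambda_p)$ of the set $\{1,\dots,k\}$ that have at least $2$ parts and no parts of cardinality $1$.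
   Context: **Polytope.** For a finite set $V$ with $|V|\ge2$ and positive integers $r_{ij}=r_{ji}$ ($i\neq j\in V$), let $\alpha_{ij}=\varepsilon_i-\varepsilon_j\in\mathbb R^V$, and let $\mathfrak A=[\alpha_1,\dots,\alpha_n]$ be the sequence in which each $\alpha_{ij}$ (for every ordered pair $i\neq j$ in $V$) is repeated $r_{ij}$ times, $n=2\sum_{\{i,j\}\subset V}r_{ij}$, $d=n-|V|+1$. Let $\mathfrak t$ be the dual of the $d$-dimensional space $\mathfrak t^*=\{m\in\mathbb R^n:\sum_i m_i\alpha_i=0\}$, and let $\beta_i\in\mathfrak t$ be the functional $m\mapsto m_i$. The Gale dual type-A root polytope of these data is the convex hull of $\beta_1,\dots,\beta_n$, a polytope of dimension $d-1$. $\Pi(r_{12},\dots,r_{k-1\,k})$ is the case $V=\{1,\dots,k\}$ and $\Pi(r_{ij\in\lambda})$ the case $V=\lambda$. **$g$- and $h$-polynomials (Stanley).** For convex polytopes define inductively: $g(\emptyset,t)=h(\emptyset,t)=1$, $\dim\emptyset=-1$; for a polytope $P$ of dimension $D\ge 0$, $$h(P,t)=\sum_{F<P}g(F,t)(t-1)^{D-1-\dim F},$$ the sum over all proper faces $F$ of $P$ including the empty face; writing $h(P,t)=\sum_{i=0}^D h_it^i$, set $g(P,t)=h_0+\sum_{i=1}^{\lfloor D/2\rfloor}(h_i-h_{i-1})t^i$. *)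

(* Defs.v *)
From HB Require Import structures.
From mathcomp Require Import all_boot all_order all_algebra.
From mathcomp Require Import boolp classical_sets cardinality fsbigop reals.

Set Implicit Arguments.
Unset Strict Implicit.
Unset Printing Implicit Defensive.

Import Order.TTheory GRing.Theory Num.Theory.

Local Open Scope classical_set_scope.
Local Open Scope ring_scope.

Section ConvexPolytopes.
Context {R : realType} {W : vectType R}.
Implicit Types P F : set W.

Definition conv_hull (I : finType) (v : I -> W) : set W :=
  [set x | exists a : I -> R,
    [/\ forall i, 0 <= a i, \sum_i a i = 1 & x = \sum_i a i *: v i]].

Definition aff_free (s : seq W) : bool :=
  if s is x :: s' then free [seq y - x | y <- s'] else true.

(* One less than the largest size of an affinely independent family of points
   of S; such a family has at most \dim {:W} + 1 members.  In particular
   affdim set0 = -1. *)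
Definition affdim (S : set W) : int :=
  (\max_(k < (\dim {:W}).+2 |
         `[< exists s : seq W,
               [/\ size s = k, aff_free s & forall x, x \in s -> S x] >]) k)%:Z
  - 1.

(* Faces cut out by valid linear inequalities; l = 0 gives both set0 and P. *)
Definition is_face P F : Prop :=
  exists (l : 'Hom(W, R^o)) (c : R),
    (forall x, P x -> l x <= c) /\ F = [set x | P x /\ l x = c].

Definition proper_faces P : set (set W) := [set F | is_face P F /\ F <> P].

Definition g_trunc (D : nat) (q : {poly int}) : {poly int} :=
  \poly_(i < D./2.+1) (if i is j.+1 then q`_i - q`_j else q`_0).

Definition g_of P (q : {poly int}) : {poly int} :=
  if `[< P = set0 >] then 1 else g_trunc `|affdim P|%N q.

(* The recursion on dimension is run with fuel N, which has to be at least
   affdim P + 1; see toric_h0, toric_hE and toric_gE for the defining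
   equations.  The sum is over a finite set of faces when P is a polytope. *)
Fixpoint toric_h_rec (N : nat) P : {poly int} :=
  if N is N'.+1 then
    if `[< P = set0 >] then 1 else
    \sum_(F \in proper_faces P)
      g_of F (toric_h_rec N' F) * ('X - 1) ^+ `|(affdim P - 1 - affdim F)%R|%N
  else 1.

Definition toric_h P : {poly int} := toric_h_rec `|(affdim P + 1)%R|%N P.

Definition toric_g P : {poly int} := g_of P (toric_h P).

Lemma toric_h0 : toric_h set0 = 1.
Proof. by rewrite /toric_h; case: (absz _) => //= n; rewrite asboolT. Qed.

Lemma toric_g0 : toric_g set0 = 1.
Proof. by rewrite /toric_g /g_of asboolT. Qed.

Lemma toric_gE P : P !=set0 -> toric_g P = g_trunc `|affdim P|%N (toric_h P).
Proof. by move=> [x Px]; rewrite /toric_g /g_of asboolF // => P0; rewrite P0 in Px. Qed.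

Lemma aff_free_size (s : seq W) : aff_free s -> (size s < (\dim {:W}).+2)%N.
Proof.
case: s => [|x s] //= fs; rewrite !ltnS -(size_map (fun y => y - x)).
by move: fs; rewrite /free => /eqP <-; rewrite dimvS // subvf.
Qed.

Lemma affdim_ge P s : aff_free s -> (forall x, x \in s -> P x) ->
  (size s)%:Z - 1 <= affdim P.
Proof.
move=> fs sP; rewrite lerD2r lez_nat.
apply: (@leq_bigmax_cond _ _ _ (Ordinal (aff_free_size fs))).
by apply/asboolP; exists s.
Qed.

Lemma affdim_witness P : exists s : seq W,
  [/\ (size s)%:Z - 1 = affdim P, aff_free s & forall x, x \in s -> P x].
Proof.
rewrite /affdim.
pose p := [pred k : 'I_(\dim {:W}).+2 | `[< exists s : seq W,
  [/\ size s = k, aff_free s & forall x, x \in s -> P x] >]].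
have p0 : (0 < #|p|)%N.
  by apply/card_gt0P; exists ord0; apply/asboolP; exists [::].
have [k /asboolP[s [sk fs sP]] kE] := eq_bigmax_cond (@nat_of_ord _) p0.
exists s; split=> //; rewrite sk -kE.
by congr (_%:Z - 1); apply: eq_bigl.
Qed.

Lemma affdim_ge0 P : P !=set0 -> 0 <= affdim P.
Proof.
move=> [x Px]; apply: (@affdim_ge P [:: x]); first by rewrite /= nil_free.
by move=> y; rewrite inE => /eqP ->.
Qed.

Lemma affdim_geN1 P : 0 <= affdim P + 1.
Proof. by rewrite /affdim subrK. Qed.

Lemma affdim_proper_face P F : proper_faces P F -> affdim F < affdim P.
Proof.
move=> [[l [c [lP FE]]] FP].
have [p Pp lp] : exists2 p, P p & l p != c.
  apply: contrapT => nex; apply: FP; rewrite FE; apply/seteqP; split=> x /=.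
    by case.
  move=> Px; split=> //; apply/eqP; apply: contrapT => /negP lx.
  by apply: nex; exists x.
have [s [<- fs sF]] := affdim_witness F.
have {sF} sF x : x \in s -> P x /\ l x = c.
  by move=> /sF; rewrite FE.
case: s fs sF => [|x s] fs sF.
  by rewrite (lt_le_trans _ (affdim_ge0 _)) //; exists p.
have [Px lx] := sF x (mem_head _ _).
apply: (@lt_le_trans _ _ ((size [:: x, p & s])%:Z - 1)).
  by rewrite ltrD2r ltz_nat.
apply: affdim_ge.
  move: fs; rewrite /= free_cons => ->; rewrite andbT; apply/negP => span_p.
  have: p - x \in lker l.
    have : (<<[seq y - x | y <- s]>> <= lker l)%VS.
      apply/span_subvP => _ /mapP[y ys ->]; rewrite memv_ker linearB /=.
      by rewrite lx (sF y _).2 ?subrr // inE ys orbT.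
    by move=> /subvP; apply.
  by rewrite memv_ker linearB /= lx subr_eq0 (negbTE lp).
move=> y; rewrite !inE => /or3P[/eqP->|/eqP->|ys] //.
by apply: (sF y _).1; rewrite inE ys orbT.
Qed.

Lemma affdim_lt_fuel P F N : proper_faces P F ->
  (`|(affdim P + 1)%R| <= N.+1)%N -> (`|(affdim F + 1)%R| <= N)%N.
Proof.
move=> /affdim_proper_face FP; rewrite -!lez_nat !gez0_abs ?affdim_geN1 // => PN.
by move: FP PN; rewrite -addn1 PoszD lerD2r -lezD1; apply: le_trans.
Qed.

Lemma toric_h_rec_fuel N M P :
  (`|(affdim P + 1)%R| <= N)%N -> (`|(affdim P + 1)%R| <= M)%N ->
  toric_h_rec N P = toric_h_rec M P.
Proof.
have fuel0 Q : (`|(affdim Q + 1)%R| <= 0)%N -> Q = set0.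
  rewrite leqn0 absz_eq0 => Q0; apply/eqP/negP => /negP/set0P/affdim_ge0.
  by rewrite leNgt -(ltrD2r 1) (eqP Q0).
elim: N M P => [|N IH] [|M] P //.
- by move=> /fuel0-> _ /=; rewrite asboolT.
- by move=> _ /fuel0-> /=; rewrite asboolT.
move=> PN PM /=; case: ifP => // _; apply: eq_fsbigr => F /set_mem PF.
by rewrite (IH M) //; apply: affdim_lt_fuel PF _.
Qed.

Lemma toric_hE P : P !=set0 ->
  toric_h P = \sum_(F \in proper_faces P)
    toric_g F * ('X - 1) ^+ `|(affdim P - 1 - affdim F)%R|%N.
Proof.
move=> P0; have [x Px] := P0.
rewrite /toric_h (@toric_h_rec_fuel _ `|(affdim P + 1)%R|.+1 P) //=.
rewrite asboolF => [|PE]; last by rewrite PE in Px.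
apply: eq_fsbigr => F /set_mem PF; congr (g_of F _ * _).
by apply: toric_h_rec_fuel => //; apply: affdim_lt_fuel PF _.
Qed.

End ConvexPolytopes.

Section GaleDual.
Context {R : realType} {E : vectType R} (A : seq E).

Definition lin_comb (m : 'rV[R]_(size A)) : E := \sum_i m 0 i *: A`_i.

Fact lin_comb_is_linear : linear lin_comb.
Proof.
move=> a u v; rewrite /lin_comb scaler_sumr -big_split /=.
by apply: eq_bigr => i _; rewrite !mxE scalerDl scalerA.
Qed.

HB.instance Definition _ :=
  GRing.isLinear.Build R 'rV[R]_(size A) E _ lin_comb lin_comb_is_linear.

Definition relations : {vspace 'rV[R]_(size A)} := lker (linfun lin_comb).

Lemma mem_relations m : (m \in relations) = (\sum_i m 0 i *: A`_i == 0).
Proof. by rewrite memv_ker lfunE. Qed.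

Definition gale_space := 'Hom(subvs_of relations, R^o).

Definition rel_coord (i : 'I_(size A)) (m : subvs_of relations) : R^o :=
  vsval m 0 i.

Fact rel_coord_is_linear i : linear (rel_coord i).
Proof. by move=> a u v; rewrite /rel_coord linearP !mxE. Qed.

HB.instance Definition _ i :=
  GRing.isLinear.Build R (subvs_of relations) R^o _ (rel_coord i)
    (rel_coord_is_linear i).

Definition gale_vec (i : 'I_(size A)) : gale_space := linfun (rel_coord i).

Lemma gale_vecE i m : gale_vec i m = vsval m 0 i.
Proof. by rewrite lfunE. Qed.

Definition gale_polytope : set gale_space := conv_hull gale_vec.

End GaleDual.

Arguments gale_polytope {R E} A _.

Section RootPolytope.
Context (R : realType) {V : finType} (r : V -> V -> nat).

Definition root_vec (i j : V) : {ffun V -> R^o} :=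
  [ffun v => (v == i)%:R - (v == j)%:R].

Definition root_seq : seq {ffun V -> R^o} :=
  flatten [seq nseq (r e.1 e.2) (root_vec e.1 e.2)
          | e <- enum {: V * V} & e.1 != e.2].

Definition gale_root_polytope : set (gale_space root_seq) :=
  gale_polytope root_seq.

End RootPolytope.

Arguments root_seq R {V} r.
Arguments gale_root_polytope R {V} r _.

Definition sub_gale_root_polytope (R : realType) (V : finType)
    (r : V -> V -> nat) (S : {set V}) :=
  gale_root_polytope R (fun i j : {x : V | x \in S} => r (val i) (val j)).

Arguments sub_gale_root_polytope R {V} r S _.

(* Set partitions of V with at least 2 parts and no part of cardinality 1. *)
Definition thick_partition (V : finType) (Q : {set {set V}}) : bool :=
  [&& finset.partition Q [set: V]%SET, (2 <= #|Q|)%N & [forall S in Q, (2 <= #|S|)%N]].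

(* The parts of Q are listed as enum_val m, m < #|Q|. *)
Definition cross_weight (V : finType) (r : V -> V -> nat)
    (Q : {set {set V}}) : nat :=
  (\sum_(m < #|Q|) \sum_(n < #|Q| | m < n)
     \sum_(i in enum_val m) \sum_(j in enum_val n) r i j)%N.

(* Main.v *)
(** The proper faces of the Gale dual polytope of a digraph correspond to the
    totally cyclic arc sets J (every arc of J lies on a directed cycle of J):
    F_J is spanned by the beta_i with i outside J, its faces are the F_J' with
    J' containing J, and dim F_J = n - |J| - c(J), where c(J) is the number of
    components of J.  Write N(A) for half the number of arcs inside A and work
    in the ring of functions of subsets of V under subset convolution, with
    lambda(F) = E F * F^-1 the logarithmic derivative for the Euler derivation
    (E F)(A) = |A| F(A).  Put w_J(t)(A) = t^N(A) if no arc of J crosses the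
    boundary of A, and 0 otherwise.  Then
      |V| (1 - t)^(c(J) - 1) g(F_J, t) = t^N(V) lambda(w_J(1/t))(V),
    because both sides satisfy the recursion that determines g: the right-hand
    side is a polynomial of degree at most dim F_J / 2, and the recursion
    amounts to an identity for lambda, which follows by cancelling digraphs
    against the choice of a union of their source components.  For empty J this
    gives
      |V| (1 - t)^|V| t^-N(V) h = lambda(w(1/t))(V) + (-1)^|V| lambda(w(t))(V),
    the logarithmic derivative at V of w(1/t) * ((-1)^|.| w(t)).  The value of
    this product at V is t^-N(V) prod_i (1 - t^r_i), so that the theorem is the
    exponential formula for set partitions. *)
Require Import Defs.
From HB Require Import structures.
From mathcomp Require Import all_boot all_order all_algebra reals.
From mathcomp Require Import boolp.
From mathcomp Require classical_sets fsbigop.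
From mathcomp Require Import ring lra zify.

Set Implicit Arguments.
Unset Strict Implicit.
Unset Printing Implicit Defensive.

Import Order.TTheory GRing.Theory Num.Theory.
Local Open Scope ring_scope.

(** * Subset convolution *)

(** Linear functionals on the Gale space are the circulations of the digraph ([gale_eval],
    [gale_lfun]), so faces are zero sets of nonnegative circulations, and the supports of these are
    exactly the totally cyclic sets. With D = dim F_J, the recursion is checked in the form (t - 1)
    h(F_J, t) = t^(D+1) g(F_J, 1/t) - g(F_J, t). Under the bound deg g <= D/2 this determines g from
    h ([g_trunc_uniq]), which is why a closed formula can be verified by induction on faces. The
    obstacle is the bound: lambda is an alternating sum in which neither divisibility by (1 -
    t)^(c(J) - 1) nor a degree is visible. The degree comes from a filtration: the exponents in
    lambda(w_J(t)) lie between |J|/2 and N(V), and t -> 1/t followed by multiplication by t^N(V)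
    reverses them. The divisibility comes from splitting lambda according to the vertex that the
    Euler derivation marks. Using lambda in place of a logarithm costs only the factor |V|, which is
    invertible in characteristic zero. *)

Definition setfun (V : finType) (K : Type) := {ffun {set V} -> K}.

Lemma subset_setUD (T : finType) (A B : {set T}) : B \subset A -> B :|: A :\: B = A.
Proof. by move=> sBA; rewrite -{2}(setID A B) (setIidPr sBA). Qed.

Section SetFunRing.
Context {V : finType} {K : comNzRingType}.
Implicit Types (F G H : setfun V K) (A B : {set V}).

HB.instance Definition _ := GRing.Zmodule.copy (setfun V K) {ffun {set V} -> K}.

Definition sf_one : setfun V K := [ffun A => (A == set0)%:R].
Definition sf_mul F G : setfun V K :=
  [ffun A : {set V} => \sum_(B : {set V} | B \subset A) F B * G (A :\: B)].

Fact sf_mulC : commutative sf_mul.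
Proof.
move=> F G; apply/ffunP => A; rewrite !ffunE.
rewrite (reindex_onto (fun B => A :\: B) (fun B => A :\: B)) /=; last first.
  by move=> B sBA; rewrite setDDr setDv set0U; apply/setIidPr.
apply: eq_big => [B|B /andP[_ /eqP EB]]; last by rewrite EB mulrC.
rewrite subsetDl /= setDDr setDv set0U; apply/eqP/idP => [<-|]; first exact: subsetIl.
by move/setIidPr.
Qed.

Fact sf_mulA : associative sf_mul.
Proof.
move=> F G H; apply/ffunP => A; rewrite !ffunE.
under eq_bigr do rewrite ffunE big_distrr /=.
under [RHS]eq_bigr do rewrite ffunE big_distrl /=.
rewrite [RHS](exchange_big_dep (fun B => B \subset A)) /=; last first.
  by move=> D B sDA sBD; apply: subset_trans sDA.
apply: eq_bigr => B sBA.
rewrite [RHS](reindex_onto (fun C => B :|: C) (fun C => C :\: B)) /=; last first.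
  by move=> D /andP[_ /subset_setUD].
apply: eq_big => [C|C sC].
  rewrite subUset sBA subsetUl /= andbT setDUl setDv set0U.
  apply/idP/andP => [|[sCA /eqP <-]]; last exact: setSD.
  rewrite subsetD => /andP[-> dC]; split=> //; apply/eqP; exact/setDidPl.
rewrite mulrA setDDl; congr (_ * G _ * _).
rewrite setDUl setDv set0U; apply/esym/setDidPl.
by move: sC; rewrite subsetD => /andP[].
Qed.

Fact sf_mul1 : left_id sf_one sf_mul.
Proof.
move=> F; apply/ffunP => A; rewrite !ffunE (bigD1 set0) ?sub0set //= ffunE eqxx.
rewrite mul1r setD0 big1 ?addr0 // => B /andP[_ /negPf nB].
by rewrite ffunE nB mul0r.
Qed.

Fact sf_mulD : left_distributive sf_mul +%R.
Proof.
move=> F G H; apply/ffunP => A; rewrite !ffunE -big_split /=.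
by apply: eq_bigr => B _; rewrite ffunE mulrDl.
Qed.

Fact sf_one_neq0 : sf_one != 0.
Proof.
apply/eqP => /ffunP/(_ set0); rewrite !ffunE eqxx => /eqP; exact/negP/oner_neq0.
Qed.

HB.instance Definition _ := GRing.Zmodule_isComNzRing.Build (setfun V K)
  sf_mulA sf_mulC sf_mul1 sf_mulD sf_one_neq0.

Lemma sf_mulE F G A :
  (F * G) A = \sum_(B : {set V} | B \subset A) F B * G (A :\: B).
Proof. by rewrite ffunE. Qed.

Lemma sf_1E A : (1 : setfun V K) A = (A == set0)%:R.
Proof. by rewrite ffunE. Qed.

Lemma sf_addE F G A : (F + G) A = F A + G A. Proof. by rewrite ffunE. Qed.
Lemma sf_oppE F A : (- F) A = - F A. Proof. by rewrite ffunE. Qed.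

Lemma sf_mul0 F G : (F * G) set0 = F set0 * G set0.
Proof.
rewrite sf_mulE (big_pred1 set0) ?setD0 // => B.
by rewrite subset0.
Qed.

(** The fuel [n] bounds the cardinality of [A]. The value at [set0] is 1 by convention, so the
    result is an inverse under the normalization [F set0 = 1] ([sf_mulV]). *)
Fixpoint sf_inv_rec (n : nat) F A : K :=
  if n is n'.+1 then
    if A == set0 then 1
    else - \sum_(B : {set V} | B \proper A) F (A :\: B) * sf_inv_rec n' F B
  else 1.

Definition sf_inv F : setfun V K := [ffun A : {set V} => sf_inv_rec #|A| F A].

Lemma sf_inv_recE n F A : (#|A| <= n)%N -> sf_inv_rec n F A = sf_inv F A.
Proof.
rewrite ffunE; suff H m k B : (#|B| <= m)%N -> (#|B| <= k)%N ->
    sf_inv_rec m F B = sf_inv_rec k F B by move=> ?; apply: H.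
elim: m k B => [|m IH] [|k] B //=.
- by rewrite leqn0 cards_eq0 => ->.
- by rewrite leqn0 cards_eq0 => _ ->.
move=> Bm Bk; case: ifP => // _; congr (- _); apply: eq_bigr => C /proper_card CB.
by rewrite (IH k) // -ltnS; apply: leq_trans CB _.
Qed.

Lemma sf_inv0 F : sf_inv F set0 = 1.
Proof. by rewrite ffunE cards0. Qed.

Lemma sf_invE F A : A != set0 ->
  sf_inv F A = - \sum_(B : {set V} | B \proper A) F (A :\: B) * sf_inv F B.
Proof.
move=> A0; rewrite -(@sf_inv_recE #|A|.+1) //= (negPf A0); congr (- _).
by apply: eq_bigr => B /proper_card/ltnW BA; rewrite sf_inv_recE.
Qed.

(** The recursion at [A] reads its argument on subsets of [A] only. This allows a digraph to be
    restricted before inverting. *)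
Lemma sf_inv_local F G A : (forall B, B \subset A -> F B = G B) ->
  sf_inv F A = sf_inv G A.
Proof.
have [n] := ubnP #|A|; elim: n A => // n IH A leAn FG.
have [->|A0] := eqVneq A set0; first by rewrite !sf_inv0.
rewrite !sf_invE //; congr (- _); apply: eq_bigr => B BA; have sBA := proper_sub BA.
rewrite FG ?subsetDl // (IH B) // => [|C sCB]; last exact/FG/(subset_trans sCB).
exact: leq_trans (proper_card BA) _.
Qed.

Lemma sf_mulV F : F set0 = 1 -> F * sf_inv F = 1.
Proof.
move=> F0; rewrite mulrC; apply/ffunP => A; rewrite sf_mulE sf_1E.
have [->|A0] := eqVneq A set0.
  by rewrite (big_pred1 set0) => [|B]; rewrite ?subset0 // setD0 F0 sf_inv0 mulr1.
rewrite (bigD1 A) //= setDv F0 mulr1 sf_invE // addrC; apply/eqP; rewrite subr_eq0.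
apply/eqP/eq_big => [B|B _]; last by rewrite mulrC.
by rewrite properEneq andbC.
Qed.

Lemma sf_invP F G : F * G = 1 -> F set0 = 1 -> G = sf_inv F.
Proof. by move=> FG F0; rewrite -[G]mulr1 -(sf_mulV F0); ring: FG. Qed.

Definition sf_scale (c : {set V} -> K) F : setfun V K := [ffun A : {set V} => c A * F A].

Lemma sf_scaleM c F G :
  (forall A B, [disjoint A & B] -> c (A :|: B) = c A * c B) ->
  sf_scale c (F * G) = sf_scale c F * sf_scale c G.
Proof.
move=> cM; apply/ffunP => A; rewrite sf_mulE ffunE sf_mulE big_distrr /=.
apply: eq_bigr => B sBA; rewrite !ffunE.
have: c A = c B * c (A :\: B).
  rewrite -cM //; last by rewrite disjoints_subset setCD subsetUr.
  by rewrite subset_setUD.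
by move=> ->; ring.
Qed.

Lemma sf_scale_derivation c F G :
  (forall A B, [disjoint A & B] -> c (A :|: B) = c A + c B) ->
  sf_scale c (F * G) = sf_scale c F * G + F * sf_scale c G.
Proof.
move=> cD; apply/ffunP => A; rewrite sf_addE !sf_mulE ffunE sf_mulE big_distrr /=.
rewrite -big_split; apply: eq_bigr => B sBA; rewrite /= !ffunE.
have: c A = c B + c (A :\: B).
  rewrite -cD //; last by rewrite disjoints_subset setCD subsetUr.
  by rewrite subset_setUD.
by move=> ->; ring.
Qed.

Definition euler := sf_scale (fun A => #|A|%:R).
Definition dlog F := euler F * sf_inv F.

Lemma eulerM F G : euler (F * G) = euler F * G + F * euler G.
Proof.
apply: sf_scale_derivation => A B dAB.
by rewrite -natrD cardsU (disjoint_setI0 dAB) cards0 subn0.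
Qed.

Lemma euler1 : euler 1 = 0.
Proof.
apply/ffunP => A; rewrite !ffunE.
by have [->|_] := eqVneq A set0; rewrite ?cards0 ?mul0r ?mulr0.
Qed.

Lemma eulerE F A : euler F A = #|A|%:R * F A. Proof. by rewrite ffunE. Qed.

Lemma euler_dlog F : F set0 = 1 -> euler F = dlog F * F.
Proof. by move=> /sf_mulV FV; rewrite /dlog -mulrA [_ * F]mulrC FV mulr1. Qed.

Lemma dlog_uniq F G : F set0 = 1 -> euler F = G * F -> G = dlog F.
Proof.
by move=> /sf_mulV FV EF; rewrite /dlog EF -mulrA FV mulr1.
Qed.

Lemma dlogM F G : F set0 = 1 -> G set0 = 1 -> dlog (F * G) = dlog F + dlog G.
Proof.
move=> F0 G0; apply/esym/dlog_uniq; first by rewrite sf_mul0 F0 G0 mulr1.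
by rewrite eulerM (euler_dlog F0) (euler_dlog G0); ring.
Qed.

(** Apply the derivation [euler] to [F * G = 1]. *)
Lemma dlog_inv F G : F set0 = 1 -> F * G = 1 -> euler F * G = - dlog G.
Proof.
move=> F0 FG; have G0 : G set0 = 1.
  by have := congr1 (fun H : setfun V K => H set0) FG; rewrite sf_mul0 F0 mul1r sf_1E eqxx.
have := eulerM F G; rewrite FG euler1 (euler_dlog G0) => /esym/eqP.
by rewrite mulrCA FG mulr1 addr_eq0 => /eqP.
Qed.

(** Here [sf_scale c] is a ring endomorphism, and it commutes with [euler] because both multiply
    pointwise. *)
Lemma dlog_scale c F : F set0 = 1 -> c set0 = 1 ->
  (forall A B, [disjoint A & B] -> c (A :|: B) = c A * c B) ->
  dlog (sf_scale c F) = sf_scale c (dlog F).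
Proof.
move=> F0 c0 cM; apply/esym/dlog_uniq; first by rewrite ffunE c0 F0 mulr1.
rewrite -sf_scaleM // -euler_dlog //; apply/ffunP => A; rewrite !ffunE.
by rewrite mulrCA.
Qed.

End SetFunRing.

(** * Totally cyclic sets of arcs *)

Section SubsetSums.
Context {I : finType}.
Implicit Types J M : {set I}.

(** A subset of [M1 :|: M2] is the same thing as the pair of its traces on [M1] and [M2]. *)
Lemma big_setU_disjoint (R : pzSemiRingType) (M1 M2 : {set I}) (P1 P2 : pred {set I})
    (f g : {set I} -> R) : [disjoint M1 & M2] ->
  (forall J, P1 J -> J \subset M1) -> (forall J, P2 J -> J \subset M2) ->
  (\sum_(J | P1 J) f J) * (\sum_(J | P2 J) g J) =
  \sum_(J : {set I} | [&& J \subset M1 :|: M2, P1 (J :&: M1) & P2 (J :&: M2)])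
    f (J :&: M1) * g (J :&: M2).
Proof.
move=> dM s1 s2; rewrite big_distrlr pair_big /=.
have M21 : M2 :&: M1 = set0 by rewrite setIC; apply: disjoint_setI0.
have capl J1 J2 : J1 \subset M1 -> J2 \subset M2 -> (J1 :|: J2) :&: M1 = J1.
  move=> /setIidPl J1M J2M; rewrite setIUl J1M; apply/setUidPl.
  by apply: subset_trans (setSI _ J2M) _; rewrite M21 sub0set.
have capr J1 J2 : J1 \subset M1 -> J2 \subset M2 -> (J1 :|: J2) :&: M2 = J2.
  move=> J1M /setIidPl J2M; rewrite setIUl J2M; apply/setUidPr.
  by apply: subset_trans (setSI _ J1M) _; rewrite setIC M21 sub0set.
rewrite (reindex_onto (fun J => (J :&: M1, J :&: M2)) (fun p => p.1 :|: p.2)) /=.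
  apply: eq_bigl => J; rewrite -setIUr andbC; congr andb.
  exact/eqP/setIidPl.
by case=> J1 J2 /= /andP[/s1 J1M /s2 J2M]; rewrite capl ?capr.
Qed.

(** Expand a product over all [i] of (factor for membership) + (factor for nonmembership): points of
    [M :\: J] are free with factors [y] and 1, points of [J :&: M] are forced in, points outside [M]
    are forced out. *)
Lemma sum_between_pow (R : comPzRingType) (y : R) J M :
  \sum_(K : {set I} | (J :&: M \subset K) && (K \subset M)) y ^+ #|K :\: J| =
  (1 + y) ^+ #|M :\: J|.
Proof.
pose F i := if i \in M then if i \in J then 1 else y else 0.
pose G i : R := if i \in J :&: M then 0 else 1.
transitivity (\prod_i (F i + G i)); last first.
  rewrite (bigID [in M :\: J]) /= [X in _ * X]big1 ?mulr1 => [|i]; last first.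
    by rewrite /F /G !inE; do 2?case: (_ \in _); rewrite ?(addr0,add0r).
  rewrite -prodr_const; apply: eq_bigr => i.
  by rewrite /F /G !inE => /andP[/negPf -> ->]; rewrite addrC.
rewrite bigA_distr big_mkcond; apply: eq_bigr => /= K _.
case: ifP => [/andP[/subsetP sJ /subsetP sM]|/negbT].
  rewrite [RHS](bigID [in K :\: J]) /= [X in _ * X]big1 ?mulr1 => [|i]; last first.
    rewrite inE; case: ifP => [iK|iK _]; first by rewrite andbT negbK /F sM // => ->.
    by rewrite /G; case: ifP => // /sJ; rewrite iK.
  rewrite -prodr_const; apply: eq_bigr => i; rewrite inE => /andP[iJ iK].
  by rewrite iK /F sM // (negPf iJ).
rewrite negb_and => /orP[] /subsetPn[i].
  by move=> iJ iK; rewrite (bigD1 i) //= (negPf iK) /G iJ mul0r.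
by move=> iK iM; rewrite (bigD1 i) //= iK /F (negPf iM) mul0r.
Qed.

End SubsetSums.

(** * Connectivity, closed sets and components of arc sets *)

Section Digraph.
Context {I V : finType} (s e : I -> V).
Implicit Types (J G : {set I}) (A B C : {set V}).

Definition arc_rel J : rel V :=
  [rel a b | [exists i in J, (s i == a) && (e i == b)]].
Definition tcyc J := [forall i in J, connect (arc_rel J) (e i) (s i)].
Definition arcs_in A := [set i | (s i \in A) && (e i \in A)].
Definition jclosed J A := [forall i in J, (s i \in A) == (e i \in A)].
(** A reachability set; it is a connected component once [J] is totally cyclic, since reachability
    is then symmetric ([tcyc_sym]). *)
Definition comp J v := [set u | connect (arc_rel J) v u].
Definition ncomp J A := #|[set comp J v | v in A]|.

Lemma arc_relP J a b :
  reflect (exists i, [/\ i \in J, s i = a & e i = b]) (arc_rel J a b).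
Proof.
apply: (iffP exists_inP) => [[i iJ /andP[/eqP sa /eqP eb]]|[i [iJ sa eb]]].
  by exists i.
by exists i; rewrite // sa eb !eqxx.
Qed.

Lemma arc_connect J i : i \in J -> connect (arc_rel J) (s i) (e i).
Proof. by move=> iJ; apply/connect1/arc_relP; exists i. Qed.

Lemma tcycP J : reflect {in J, forall i, connect (arc_rel J) (e i) (s i)} (tcyc J).
Proof. exact: forall_inP. Qed.

Lemma jclosedP J A : reflect {in J, forall i, (s i \in A) = (e i \in A)} (jclosed J A).
Proof. by apply: (iffP forall_inP) => H i /H /eqP. Qed.

Lemma connect_fwd J A u v : {in J, forall i, s i \in A -> e i \in A} ->
  connect (arc_rel J) u v -> u \in A -> v \in A.
Proof.
move=> cl /connectP[p]; elim: p u => [|w p IH] u /=; first by move=> _ ->.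
case/andP => /arc_relP[i [iJ <- <-]] pth lst uA.
by apply: IH pth lst _; apply: cl.
Qed.

Lemma connect_bwd J A u v : {in J, forall i, e i \in A -> s i \in A} ->
  connect (arc_rel J) u v -> v \in A -> u \in A.
Proof.
move=> cl /(@connect_fwd J (~: A)) H vA; apply: contraLR vA => uA.
have: v \in ~: A; last by rewrite inE.
by apply: H; rewrite ?inE // => i iJ; rewrite !inE; apply: contra; apply: cl.
Qed.

Lemma connect_mono J G u v : J \subset G ->
  connect (arc_rel J) u v -> connect (arc_rel G) u v.
Proof.
move=> /subsetP sJG; apply: connect_sub => a b /arc_relP[i [iJ <- <-]].
exact/arc_connect/sJG.
Qed.

(** A path that starts in a forward closed set never leaves it, so all its arcs have both ends
    there. *)
Lemma connect_fwd_local J A u v : {in J, forall i, s i \in A -> e i \in A} ->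
  u \in A -> connect (arc_rel J) u v -> connect (arc_rel (J :&: arcs_in A)) u v.
Proof.
move=> cl uA uv; pose B := [set w in A | connect (arc_rel (J :&: arcs_in A)) u w].
suff: v \in B by rewrite inE => /andP[].
apply: connect_fwd uv _; last by rewrite inE uA connect0.
move=> i iJ; rewrite !inE => /andP[siA ui]; rewrite cl //=.
by apply: connect_trans ui _; apply: arc_connect; rewrite !inE iJ siA cl.
Qed.

Lemma connect_bwd_local J A u v : {in J, forall i, e i \in A -> s i \in A} ->
  v \in A -> connect (arc_rel J) u v -> connect (arc_rel (J :&: arcs_in A)) u v.
Proof.
move=> cl vA uv; pose B := [set w in A | connect (arc_rel (J :&: arcs_in A)) w v].
suff: u \in B by rewrite inE => /andP[].
apply: connect_bwd uv _; last by rewrite inE vA connect0.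
move=> i iJ; rewrite !inE => /andP[eiA ui]; rewrite cl //=.
by apply: connect_trans ui; apply: arc_connect; rewrite !inE iJ eiA cl.
Qed.

Lemma tcyc_sym J : tcyc J -> connect_sym (arc_rel J).
Proof.
move=> /tcycP tJ; suff H u v : connect (arc_rel J) u v -> connect (arc_rel J) v u.
  by move=> u v; apply/idP/idP; apply: H.
move=> uv; have: v \in [set w | connect (arc_rel J) w u]; last by rewrite inE.
apply: connect_fwd uv _; last by rewrite inE connect0.
by move=> i iJ; rewrite !inE; apply: connect_trans; apply: tJ.
Qed.

(** An arc of [J] leaving [A] lies on a cycle, which would have to enter [A] again. *)
Lemma tcyc_jclosed J A : tcyc J -> {in J, forall i, e i \in A -> s i \in A} ->
  jclosed J A.
Proof.
move=> /tcycP tJ cl; apply/jclosedP => i iJ; apply/idP/idP; last exact: cl.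
by apply: connect_bwd (tJ i iJ).
Qed.

Lemma jclosed_sub J G A : J \subset G -> jclosed G A -> jclosed J A.
Proof. by move=> /subsetP sJG /jclosedP cG; apply/jclosedP => i /sJG /cG. Qed.

Lemma jclosedD J A C : jclosed J A -> jclosed J C -> jclosed J (C :\: A).
Proof.
by move=> /jclosedP cA /jclosedP cC; apply/jclosedP => i iJ; rewrite !inE cA // cC.
Qed.

Lemma jclosedU J A C : jclosed J A -> jclosed J C -> jclosed J (A :|: C).
Proof.
by move=> /jclosedP cA /jclosedP cC; apply/jclosedP => i iJ; rewrite !inE cA // cC.
Qed.

Lemma jclosed0 J : jclosed J set0.
Proof. by apply/jclosedP => i _; rewrite !inE. Qed.

Lemma jclosedT J : jclosed J [set: V].
Proof. by apply/jclosedP => i _; rewrite !inE. Qed.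

Lemma mem_comp J v : v \in comp J v. Proof. by rewrite inE connect0. Qed.

Lemma comp_sub J A v : jclosed J A -> v \in A -> comp J v \subset A.
Proof.
move=> /jclosedP cA vA; apply/subsetP => u; rewrite inE => vu.
by apply: connect_fwd vu vA => i /cA ->.
Qed.

Lemma comp_local J A v : jclosed J A -> v \in A ->
  comp (J :&: arcs_in A) v = comp J v.
Proof.
move=> /jclosedP cA vA; apply/setP => u; rewrite !inE; apply/idP/idP.
  exact/connect_mono/subsetIl.
by apply: connect_fwd_local => // i /cA ->.
Qed.

Lemma ncomp_local J A : jclosed J A -> ncomp (J :&: arcs_in A) A = ncomp J A.
Proof.
by move=> cA; congr #|pred_of_set _|; apply: eq_in_imset => v; apply: comp_local.
Qed.

Lemma ncompU J A B : jclosed J A -> jclosed J B -> [disjoint A & B] ->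
  ncomp J (A :|: B) = (ncomp J A + ncomp J B)%N.
Proof.
move=> cA cB dAB; rewrite /ncomp imsetU cardsU disjoint_setI0 ?cards0 ?subn0 //.
rewrite -setI_eq0; apply/eqP/setP => X; rewrite !inE; apply/negP => /andP[].
move=> /imsetP[a aA ->] /imsetP[b bB /setP/(_ a)]; rewrite mem_comp => /esym abB.
have /subsetP/(_ _ abB) aB := comp_sub cB bB.
by move: dAB; rewrite disjoint_subset => /subsetP/(_ a aA); rewrite !inE aB.
Qed.

Lemma ncompD J A C : jclosed J A -> jclosed J C -> A \subset C ->
  ncomp J C = (ncomp J A + ncomp J (C :\: A))%N.
Proof.
move=> cA cC sAC; rewrite -ncompU ?subset_setUD ?jclosedD //.
by rewrite disjoints_subset setCD subsetUr.
Qed.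

Lemma ncomp0 J : ncomp J set0 = 0%N.
Proof. by rewrite /ncomp imset0 cards0. Qed.

Lemma ncomp_arcless A : ncomp set0 A = #|A|.
Proof.
rewrite /ncomp card_imset // => u v /setP/(_ v); rewrite mem_comp inE.
by move/connectP => [[|w p]] //= /andP[/arc_relP[i []]]; rewrite inE.
Qed.

Lemma ncomp_gt0 J A : A != set0 -> (0 < ncomp J A)%N.
Proof. by case/set0Pn => v vA; apply/card_gt0P; exists (comp J v); apply: imset_f. Qed.

Lemma ncomp1 J A : A != set0 -> jclosed J A ->
  {in A &, forall u v, connect (arc_rel J) u v} -> ncomp J A = 1%N.
Proof.
case/set0Pn => v vA cA cnt; apply/eqP/cards1P; exists A.
apply/setP => X; rewrite inE; apply/imsetP/eqP => [[u uA ->]|->]; last exists v => //.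
  apply/eqP; rewrite eqEsubset comp_sub //=.
  by apply/subsetP => w wA; rewrite inE cnt.
apply/eqP; rewrite eqEsubset comp_sub // andbT.
by apply/subsetP => w wA; rewrite inE cnt.
Qed.

Lemma arcs_inS A B : A \subset B -> arcs_in A \subset arcs_in B.
Proof.
by move=> /subsetP sAB; apply/subsetP => i; rewrite !inE => /andP[/sAB -> /sAB].
Qed.

Lemma arcs_in_disjoint A B : [disjoint A & B] -> [disjoint arcs_in A & arcs_in B].
Proof.
rewrite -!setI_eq0 => /eqP/setP dAB; apply/eqP/setP => i; have := dAB (s i).
by rewrite !inE; case: (s i \in A); case: (s i \in B); rewrite ?andbF.
Qed.

Lemma arcs_in0 : arcs_in set0 = set0.
Proof. by apply/setP => i; rewrite !inE. Qed.

Lemma arcs_inT : arcs_in setT = setT.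
Proof. by apply/setP => i; rewrite !inE. Qed.

(* Toggling a source strongly connected component of [G] changes the number of
   components by one. *)
Lemma source_sum0 (R : nzRingType) G C : C != set0 -> G \subset arcs_in C ->
  \sum_(A : {set V} | [&& A \subset C, [forall i in G, (e i \in A) ==> (s i \in A)]
      & tcyc (G :&: arcs_in A)]) (-1) ^+ ncomp (G :&: arcs_in A) A = 0 :> R.
Proof.
move=> C0 /subsetP sGC; 
pose valid (A : {set V}) := [&& A \subset C,
  [forall i in G, (e i \in A) ==> (s i \in A)] & tcyc (G :&: arcs_in A)].
rewrite (eq_bigl valid) //.
have inclP A : reflect {in G, forall i, e i \in A -> s i \in A}
    [forall i in G, (e i \in A) ==> (s i \in A)].
  by apply: (iffP forall_inP) => H i /H /implyP.
have [K [K0 sKC inK scK]] : exists K : {set V}, [/\ K != set0, K \subset C,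
    {in G, forall i, e i \in K -> s i \in K} & {in K &, forall u v, connect (arc_rel G) u v}].
  pose anc v := [set u | connect (arc_rel G) u v].
  have inG v : {in G, forall i, e i \in anc v -> s i \in anc v}.
    move=> i iG; rewrite !inE; exact/connect_trans/arc_connect.
  have [v0 v0C] := set0Pn _ C0.
  (* A smallest ancestor set serves as [K]: the ancestors of any member form an ancestor set inside
     it, hence all of it, which makes it strongly connected. *)
  case: (@arg_minnP _ v0 [in C] (fun v => #|anc v|) v0C) => v vC vmin.
  have sancC : anc v \subset C.
    apply/subsetP => u; rewrite inE => uv; apply: connect_bwd uv vC.
    by move=> i /sGC; rewrite inE => /andP[].
  exists (anc v); split=> //; first by apply/set0Pn; exists v; rewrite inE connect0.
  move=> u w; rewrite inE => uv; rewrite inE => wv.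
  have sanc : anc w \subset anc v.
    by apply/subsetP => z; rewrite !inE => zw; apply: connect_trans wv.
  have/eqP ancE : anc w == anc v.
    by rewrite eqEcard sanc vmin // (subsetP sancC) // inE.
  have: v \in anc w by rewrite ancE inE connect0.
  by rewrite inE; apply: connect_trans uv.
have KA A : {in G, forall i, e i \in A -> s i \in A} -> ~~ [disjoint A & K] -> K \subset A.
  move=> inA /pred0Pn[w /andP[/= wA wK]]; apply/subsetP => u uK.
  by apply: (connect_bwd inA) wA; apply: scK.
have GU A : {in G, forall i, e i \in A -> s i \in A} -> [disjoint A & K] ->
    jclosed (G :&: arcs_in (A :|: K)) A.
  move=> inA dAK; have dAKP x : x \in A -> x \in K -> false.
    by move=> xA xK; move/pred0P: dAK => /(_ x) /=; rewrite xA xK.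
  apply/jclosedP => i; rewrite !inE => /andP[iG /andP[_ eAK]].
  apply/idP/idP => [sA|/inA]; last exact.
  by case/orP: eAK => // /inK => /(_ iG) /(dAKP _ sA).
have GUK A : {in G, forall i, e i \in A -> s i \in A} -> [disjoint A & K] ->
    jclosed (G :&: arcs_in (A :|: K)) K.
  move=> inA dAK; rewrite (_ : K = (A :|: K) :\: A); last first.
    rewrite setDUl setDv set0U; apply/esym/setDidPl; by rewrite disjoint_sym.
  rewrite subset_setUD ?subsetUl //; apply: jclosedD (GU _ inA dAK) _.
  by apply/jclosedP => i; rewrite !inE => /andP[_ /andP[-> ->]].
have sub_id A B : A \subset B -> G :&: arcs_in B :&: arcs_in A = G :&: arcs_in A.
  by move=> /arcs_inS /setIidPr AB; rewrite -setIA AB.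
have validU A : [disjoint A & K] -> valid (A :|: K) = valid A.
  move=> dAK; have dAKP x : x \in A -> x \in K -> false.
    by move=> xA xK; move/pred0P: dAK => /(_ x) /=; rewrite xA xK.
  apply/and3P/and3P => -[sC /inclP inA /tcycP tA].
    (* An arc from [K] into [A] would lie on a cycle inside [A :|: K]; its head would then be an
       ancestor of a point of [K], hence in [K], against disjointness. *)
    have {}inA' : {in G, forall i, e i \in A -> s i \in A}.
      move=> i iG eA; have := inA i iG; rewrite !inE eA => /(_ isT) /orP[//|sK].
      have iU : i \in G :&: arcs_in (A :|: K) by rewrite !inE iG eA sK orbT.
      suff /(dAKP _ eA) : e i \in K by [].
      apply: connect_bwd (tA i iU) sK => j; rewrite inE => /andP[jG _]; exact: inK.
    split; [exact: subset_trans (subsetUl _ _) sC | exact/inclP |].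
    apply/tcycP => i iA; have := iA; rewrite !inE => /and3P[iG sA eA].
    rewrite -(sub_id A (A :|: K)) ?subsetUl //; apply: connect_bwd_local => //.
      by move=> j; rewrite inE => /andP[jG _]; apply: inA'.
    by apply: tA; rewrite !inE iG sA eA.
  split.
  - by rewrite subUset sC.
  - apply/inclP => i iG; rewrite !inE => /orP[/(inA _ iG) ->//|/(inK _ iG) ->].
    by rewrite orbT.
  apply/tcycP => i; rewrite 3!inE => /and3P[iG siU eiU].
  have cA : jclosed (G :&: arcs_in (A :|: K)) A by apply: GU.
  have [eA|eA] := boolP (e i \in A).
    apply: connect_mono (tA i _); first by apply/setIS/arcs_inS/subsetUl.
    by rewrite !inE iG eA inA.
  have {}eiK : e i \in K by move: eiU; rewrite inE (negPf eA).
  apply: (@connect_mono (G :&: arcs_in K)); first by apply/setIS/arcs_inS/subsetUr.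
  by apply: connect_bwd_local; rewrite ?scK ?inK.
have signU A : [disjoint A & K] -> valid A ->
    (-1) ^+ ncomp (G :&: arcs_in (A :|: K)) (A :|: K) =
    - (-1) ^+ ncomp (G :&: arcs_in A) A :> R.
  move=> dAK /and3P[_ /inclP inA _]; rewrite ncompU ?GU ?GUK //.
  rewrite -ncomp_local ?GU // sub_id ?subsetUl //.
  rewrite -(ncomp_local (GUK _ inA dAK)) sub_id ?subsetUr //.
  rewrite (@ncomp1 _ K) ?addn1 ?exprS ?mulN1r //.
    by apply/jclosedP => i; rewrite !inE => /andP[_ /andP[-> ->]].
  by move=> u v uK vK; apply: connect_bwd_local; rewrite ?scK.
(* By [KA] a backward closed set either misses [K] or contains it, so [A] and [A :|: K] pair off all
   terms, with opposite signs by [signU]. *)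
rewrite (bigID (fun A : {set V} => [disjoint A & K])) /=.
rewrite [X in _ + X](reindex_onto (fun A => A :|: K) (fun A => A :\: K)) /=; last first.
  move=> A /andP[/and3P[_ /inclP inA _]] /(KA _ inA).
  by rewrite setUC => /subset_setUD.
rewrite -[X in _ + X]opprK; apply/eqP; rewrite subr_eq0 -sumrN; apply/eqP.
have dE A : ~~ [disjoint A :|: K & K] && ((A :|: K) :\: K == A) = [disjoint A & K].
  rewrite setDUl setDv setU0; apply/andP/idP => [[_ /eqP/setDidPl]//|dAK].
  split; last exact/eqP/setDidPl.
  by case/set0Pn: K0 => k kK; apply/pred0Pn; exists k; rewrite /= !inE kK orbT.
apply: eq_big => [A|A /andP[vA dAK]]; last by rewrite signU ?opprK.
by rewrite -andbA dE andbC [RHS]andbC; case: (boolP [disjoint A & K]) => // /validU ->.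
Qed.

End Digraph.

(** * The Kazhdan-Lusztig-Stanley identity *)

Section Kernel.
Context {I V : finType} (s e : I -> V) (N : {set V} -> nat).
Hypothesis card_arcs_in : forall A, #|arcs_in s e A| = (N A).*2.
Hypothesis balanced : forall A B : {set V},
  #|[set i | (s i \in A) && (e i \in B)]| = #|[set i | (s i \in B) && (e i \in A)]|.

Implicit Types (J G : {set I}) (A B C : {set V}).
Local Notation arcs_in := (arcs_in s e).
Local Notation jclosed := (jclosed s e).
Local Notation tcyc := (tcyc s e).
Local Notation ncomp := (ncomp s e).

Lemma N0 : N set0 = 0%N.
Proof. by have := card_arcs_in set0; rewrite arcs_in0 cards0; case: (N _). Qed.

(** After doubling, both sides count the arcs inside [A :|: B]; the two crossing directions are
    equally frequent by [balanced]. *)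
Lemma N_setU A B : [disjoint A & B] ->
  N (A :|: B) = (N A + N B + #|[set i | (s i \in A) && (e i \in B)]|)%N.
Proof.
move=> dAB; apply: double_inj; rewrite !doubleD -!card_arcs_in -(addnn #|_|).
rewrite [X in (_ + (_ + X))%N]balanced.
have dABP x : x \in A -> x \in B -> False.
  by move=> xA xB; move/pred0P: dAB => /(_ x) /=; rewrite xA xB.
have cardU (X Y : {set I}) : [disjoint X & Y] -> (#|X| + #|Y| = #|X :|: Y|)%N.
  by move=> dXY; rewrite cardsU disjoint_setI0 // cards0 subn0.
have dis (X Y : {set I}) : (forall i, i \in X -> i \in Y -> False) -> [disjoint X & Y].
  by move=> dXY; apply/pred0P => i /=; apply/negP => /andP[iX]; apply: dXY.
rewrite addnA !cardU.
- apply: eq_card => i; rewrite !inE.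
  by case: (s i \in A); case: (s i \in B); case: (e i \in A); case: (e i \in B).
- apply: dis => i; rewrite !inE => H /andP[sB eA]; case/orP: H => [/orP[]|] /andP[sX eX].
  + exact: dABP sX sB.
  + exact: dABP eA eX.
  + exact: dABP sX sB.
- apply: dis => i; rewrite !inE => /orP[] /andP[sX eX] /andP[sY eY].
    exact: dABP eX eY.
  exact: dABP sY sX.
by apply: dis => i; rewrite !inE => /andP[sA _] /andP[sB _]; apply: dABP sA sB.
Qed.

Definition wt {K : pzSemiRingType} G (x : K) : setfun V K :=
  [ffun A : {set V} => (jclosed G A)%:R * x ^+ N A].

Lemma wt0 (K : pzSemiRingType) G (x : K) : wt G x set0 = 1.
Proof. by rewrite ffunE jclosed0 N0 mulr1. Qed.

Definition tc_between J A G := [&& J :&: arcs_in A \subset G, G \subset arcs_in A & tcyc G].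

(** A cycle of [G] stays on one side of a [G]-closed set, so total cyclicity can be tested on the
    two restrictions. Closedness passes from [G] to [J] because [G] contains the arcs of [J] inside
    [C]. *)
Lemma tc_between_split J C A G : jclosed J C -> A \subset C ->
  tc_between J C G && jclosed G A =
  jclosed J A && [&& G \subset arcs_in A :|: arcs_in (C :\: A),
    tc_between J A (G :&: arcs_in A) & tc_between J (C :\: A) (G :&: arcs_in (C :\: A))].
Proof.
move=> cJC sAC; have /subsetP sACP := sAC.
have [sA sD] := (arcs_inS s e sAC, arcs_inS s e (subsetDl C A)).
apply/andP/andP => [[/and3P[/subsetP JG sGC tG] cGA]|[cJA /and3P[sG /and3P[JA _ tA] /and3P[JD _ tD]]]].
  have cGC : jclosed G C.
    apply/jclosedP => i /(subsetP sGC); by rewrite !inE => /andP[-> ->].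
  have/jclosedP cGD : jclosed G (C :\: A) by apply: jclosedD.
  have/jclosedP cGAP := cGA.
  split.
    apply/jclosedP => i iJ; have := jclosedP _ _ _ _ cJC i iJ.
    have [sC eC|sC /esym eC] := boolP (s i \in C).
      by rewrite cGAP // JG // !inE iJ sC -eC.
    by rewrite !(contraNF (sACP _)) ?eC.
  apply/and3P; split.
  - apply/subsetP => i iG; move: (subsetP sGC i iG) (cGAP i iG); rewrite !inE.
    by move=> /andP[-> ->] ->; case: (e i \in A).
  - apply/and3P; split; last 2 first.
    + exact: subsetIr.
    + apply/tcycP => i; rewrite inE => /andP[iG]; rewrite inE => /andP[_ eA].
      by apply: connect_fwd_local (tcycP _ _ _ tG i iG) => // j /cGAP ->.
    apply/subsetP => i; rewrite in_setI => /andP[iJ iA].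
    by rewrite in_setI iA andbT JG // in_setI iJ (subsetP sA).
  apply/and3P; split; last 2 first.
  - exact: subsetIr.
  - apply/tcycP => i; rewrite inE => /andP[iG]; rewrite inE => /andP[_ eA].
    by apply: connect_fwd_local (tcycP _ _ _ tG i iG) => // j /cGD ->.
  apply/subsetP => i; rewrite in_setI => /andP[iJ iA].
  by rewrite in_setI iA andbT JG // in_setI iJ (subsetP sD).
split; last first.
  apply/jclosedP => i /(subsetP sG); rewrite !inE.
  by case/orP=> /andP[]; [move=> -> -> | move=> /andP[/negPf -> _] /andP[/negPf ->]].
apply/and3P; split.
- apply/subsetP => i; rewrite !inE => /and3P[iJ siC eiC].
  have := jclosedP _ _ _ _ cJA i iJ; case: (boolP (e i \in A)) => [eA sA'|eA sA'].
    by have := subsetP JA i; rewrite !inE iJ eA sA' => /(_ isT) /andP[].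
  have := subsetP JD i; rewrite !inE iJ eA sA' siC eiC => /(_ isT) /andP[] //.
- by apply: subset_trans sG _; rewrite subUset sA.
apply/tcycP => i iG; have := subsetP sG i iG; rewrite inE => /orP[] iX.
  by apply: connect_mono (tcycP _ _ _ tA i _); rewrite ?subsetIl // inE iG.
by apply: connect_mono (tcycP _ _ _ tD i _); rewrite ?subsetIl // inE iG.
Qed.

Section Field.
Context {K : fieldType} (x : K).
Hypothesis x_neq0 : x != 0.

Definition tc_weight J G A : K := (-1) ^+ ncomp G A * (x - 1) ^+ #|G :\: J|.

(* [kernel_identity] is the vanishing of the logarithmic derivative of
   [tc_sum J * wt_rel J = 1]; [tc_inv_sum J] is a second inverse of [tc_sum J]. *)
Definition tc_sum J : setfun V K :=
  [ffun A : {set V} => (jclosed J A)%:R * x^-1 ^+ N A * \sum_(G | tc_between J A G) tc_weight J G A].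

Definition tc_inv_sum J : setfun V K :=
  [ffun C : {set V} => (jclosed J C)%:R *
     \sum_(G | tc_between J C G) tc_weight J G C * sf_inv (wt G x^-1) C].

Lemma jclosed_tc_between J C G : tc_between J C G -> jclosed G C.
Proof.
move=> /and3P[_ /subsetP sGC _]; apply/jclosedP => i /sGC.
by rewrite inE => /andP[-> ->].
Qed.

Lemma tc_weight_split J C A G : tc_between J C G -> jclosed G A -> A \subset C ->
  tc_weight J G C = tc_weight J (G :&: arcs_in A) A *
              tc_weight J (G :&: arcs_in (C :\: A)) (C :\: A).
Proof.
move=> oG cA sAC; have cC := jclosed_tc_between oG.
rewrite /tc_weight (ncompD cA cC sAC) (ncomp_local cA) (ncomp_local (jclosedD cA cC)).
rewrite mulrACA -!exprD; congr (_ * _ ^+ _).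
rewrite !setDIl -cardsUI.
case/and3P: oG => _ /subsetP sGC _; rewrite [X in (_ + X)%N]eq_card0 ?addn0.
  apply: eq_card => i; rewrite !inE; case: (i \in J) => //=.
  case iG: (i \in G) => //=; have := jclosedP _ _ _ _ cA i iG.
  by have := sGC i iG; rewrite inE => /andP[-> ->] ->; case: (e i \in A).
move=> i; rewrite !inE; case: (s i \in A); rewrite ?andbF //.
Qed.

(** For subsets of the [G]-closed set [C :\: A], being closed under [G] only concerns the arcs
    inside [C :\: A]. *)
Lemma wt_inv_split J C A G : tc_between J C G -> jclosed G A -> A \subset C ->
  sf_inv (wt G x^-1) (C :\: A) = sf_inv (wt (G :&: arcs_in (C :\: A)) x^-1) (C :\: A).
Proof.
move=> oG cA sAC; have cC := jclosed_tc_between oG.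
have /jclosedP cD : jclosed G (C :\: A) by apply: jclosedD.
apply: sf_inv_local => B sB; rewrite !ffunE; congr ((nat_of_bool _)%:R * _).
apply/idP/idP => [|/jclosedP cB]; first by apply: jclosed_sub; apply: subsetIl.
apply/jclosedP => i iG; case: (boolP (i \in arcs_in (C :\: A))) => iD.
  by apply: cB; rewrite inE iG.
have sBP := subsetP sB.
have nB : e i \notin C :\: A.
  by move: iD; rewrite inE cD // andbb.
by rewrite (contraNF (sBP (s i))) ?cD // (contraNF (sBP (e i))).
Qed.

(** The digraphs on [A] and [C :\: A] that the two factors sum over glue to one [G] for which [A] is
    closed, and that condition is the support of [wt G]. The case [phi = 1] gives [tc_inv_sumP];
    with [phi] the cardinality, the inner sums become [dlog (wt G x^-1)], the left-hand side of
    [kernel_identity]. *)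
Lemma tc_sum_mul (phi : {set V} -> K) J C : jclosed J C ->
  (sf_scale phi (tc_sum J) * tc_inv_sum J) C =
  \sum_(G | tc_between J C G) tc_weight J G C *
     \sum_(A : {set V} | A \subset C) phi A * wt G x^-1 A * sf_inv (wt G x^-1) (C :\: A).
Proof.
move=> cJC; rewrite sf_mulE; under [RHS]eq_bigr do rewrite big_distrr /=.
rewrite exchange_big /=; apply: eq_bigr => A sAC; rewrite !ffunE.
under [RHS]eq_bigr do rewrite ffunE.
transitivity (phi A * x^-1 ^+ N A * \sum_(G | tc_between J C G && jclosed G A)
    tc_weight J G C * sf_inv (wt G x^-1) (C :\: A)); last first.
  rewrite big_mkcondr /= big_distrr /=; apply: eq_bigr => G _.
  by case: ifP => _; rewrite ?mulr0 ?mul0r ?mulr0 //=; ring.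
rewrite (eq_bigl _ _ (fun G => tc_between_split G cJC sAC)).
have [cA|cA] := boolP (jclosed J A); last by rewrite big_pred0_eq !(mul0r, mulr0).
have cD : jclosed J (C :\: A) by apply: jclosedD.
rewrite cD !mul1r -!mulrA; congr (_ * (_ * _)).
have dAD : [disjoint A & C :\: A] by rewrite disjoints_subset setCD subsetUr.
rewrite (big_setU_disjoint _ _ (arcs_in_disjoint s e dAD)); last first.
- by move=> G /and3P[].
- by move=> G /and3P[].
apply: eq_bigr => G oG.
have /andP[oG' cG'] : tc_between J C G && jclosed G A by rewrite tc_between_split // cA.
by rewrite (tc_weight_split oG' cG' sAC) (wt_inv_split oG' cG' sAC) mulrA.
Qed.

Lemma tc_between0 J G : tc_between J set0 G = (G == set0).
Proof.
rewrite /tc_between arcs_in0 setI0 sub0set subset0; case: eqVneq => //= ->.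
by apply/tcycP => i; rewrite inE.
Qed.

Lemma tc_sum0 J : tc_sum J set0 = 1.
Proof.
rewrite ffunE jclosed0 N0 expr0 !mul1r (eq_bigl _ _ (tc_between0 J)) big_pred1_eq.
by rewrite /tc_weight ncomp0 set0D cards0 !expr0 mulr1.
Qed.

Lemma tc_inv_sumP J : tc_sum J * tc_inv_sum J = 1.
Proof.
apply/ffunP => C; rewrite sf_1E.
have [cC|cC] := boolP (jclosed J C); last first.
  have C0 : (C == set0) = false by apply: contraNF cC => /eqP ->; apply: jclosed0.
  rewrite sf_mulE C0 big1 // => A sAC; rewrite !ffunE.
  have [cA|] := boolP (jclosed J A); last by rewrite !mul0r.
  have [cD|] := boolP (jclosed J (C :\: A)); last by rewrite mul0r mulr0.
  by move: cC; rewrite -(subset_setUD sAC) jclosedU.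
have := tc_sum_mul (fun=> 1) cC.
rewrite (_ : sf_scale _ _ = tc_sum J); last first.
  by apply/ffunP => A; rewrite !ffunE mul1r.
move=> ->.
transitivity (\sum_(G | tc_between J C G) tc_weight J G C * (C == set0)%:R).
  apply: eq_bigr => G _; congr (_ * _).
  have := congr1 (fun F : setfun V K => F C) (sf_mulV (wt0 G x^-1)).
  rewrite sf_mulE sf_1E => <-.
  by apply: eq_bigr => A _; rewrite mul1r.
have [->|C0] := eqVneq C set0; last by rewrite big1 // => G _; rewrite mulr0.
rewrite (eq_bigl _ _ (tc_between0 J)) big_pred1_eq.
by rewrite /tc_weight ncomp0 set0D cards0 !expr0 !mulr1.
Qed.

(** For closed [A] the twisting exponent counts the arcs of [J] inside [A]. It is additive in [A],
    so [dlog_scale] applies and [dlog] at [[set: V]] only picks up the factor [x^-1 ^+ #|J|]. *)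
Definition wt_rel J : setfun V K :=
  sf_scale (fun A => x^-1 ^+ #|[set i in J | s i \in A]|) (wt J x).

(** The arcs inside [C] with head outside [A] number 2 N(D) plus the arcs from [A] to D, that is
    N(C) - N(A) + N(D). Those belonging to [J] are the arcs of [J] that start in D, as [A] and [C]
    are [J]-closed. *)
Lemma pow_balance J C A : tcyc J -> jclosed J C -> A \subset C -> jclosed J A ->
  x ^+ N C * (x^-1 ^+ N A * (x^-1 ^+ #|[set i in J | s i \in C :\: A]| * x ^+ N (C :\: A)))
  = x ^+ #|[set i in arcs_in C | e i \notin A] :\: J|.
Proof.
move=> tJ cC sAC cA; set D := C :\: A.
set M := [set i in arcs_in C | e i \notin A].
have dAD : [disjoint A & D] by rewrite disjoints_subset setCD subsetUr.
have NC : N C = (N A + N D + #|[set i | (s i \in A) && (e i \in D)]|)%N.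
  by rewrite -N_setU // subset_setUD.
have cardM : #|M| = ((N D).*2 + #|[set i | (s i \in A) && (e i \in D)]|)%N.
  rewrite -card_arcs_in -cardsUI [X in (_ + X)%N]eq_card0 ?addn0 => [|i].
    apply: eq_card => i; rewrite !inE.
    case sA: (s i \in A); rewrite ?(subsetP sAC _ sA) /=;
    by case: (s i \in C); case: (e i \in C); case: (e i \in A).
  by rewrite !inE; case: (s i \in A) => //=; rewrite andbF.
have <- : #|M :&: J| = #|[set i in J | s i \in D]|.
  apply: eq_card => i; rewrite !inE andbC; case iJ: (i \in J) => //=.
  have -> := jclosedP _ _ _ _ cA i iJ; have -> := jclosedP _ _ _ _ cC i iJ.
  by rewrite andbb andbC.
have cMJ : (#|M :&: J| <= #|M|)%N by apply/subset_leq_card/subsetIl.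
rewrite cardsD NC.
have xn k : x ^+ k != 0 by rewrite expf_neq0.
apply: (mulIf (xn #|M :&: J|)); rewrite -[RHS]exprD subnK // cardM.
rewrite -addnn !exprD !exprVn; field.
by rewrite !xn.
Qed.

(** By [pow_balance] the second factor contributes a power of x = 1 + (x - 1), which expands into a
    choice of arcs with head outside [A]. Joined to the totally cyclic part inside [A], these give
    every [G] that has no arc entering [A] and is totally cyclic on [A]. For fixed [G] the sum over
    [A] vanishes by [source_sum0]. *)
Lemma tc_sumP J : tcyc J -> tc_sum J * wt_rel J = 1.
Proof.
move=> tJ; apply/ffunP => C; rewrite sf_mulE sf_1E.
have [->|C0] := eqVneq C set0.
  rewrite (big_pred1 set0) => [|B]; last by rewrite subset0.
  rewrite setD0 tc_sum0 !ffunE jclosed0 N0 !mulr1 mul1r eq_card0 // => i.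
  by rewrite !inE andbF.
have [cC|cC] := boolP (jclosed J C); last first.
  rewrite big1 // => A sAC; rewrite !ffunE.
  have [cA|] := boolP (jclosed J A); last by rewrite !mul0r.
  have [cD|] := boolP (jclosed J (C :\: A)); last by rewrite mul0r !mulr0.
  by move: cC; rewrite -(subset_setUD sAC) jclosedU.
apply: (mulfI (expf_neq0 (N C) x_neq0)); rewrite mulr0 big_distrr /=.
pose M A := [set i in arcs_in C | e i \notin A].
transitivity (\sum_(A : {set V} | A \subset C) \sum_(G : {set I} |
   [&& J :&: arcs_in C \subset G, G \subset arcs_in C,
    [forall i in G, (e i \in A) ==> (s i \in A)] & tcyc (G :&: arcs_in A)])
     (-1) ^+ ncomp (G :&: arcs_in A) A * (x - 1) ^+ #|G :\: J|); last first.
  rewrite (exchange_big_dep (fun G => (J :&: arcs_in C \subset G) && (G \subset arcs_in C))) /=;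
    last by move=> A G _ /and4P[-> ->].
  rewrite big1 // => G /andP[JG sGC]; rewrite -big_distrl /= -[RHS](mul0r ((x - 1) ^+ #|G :\: J|)).
  congr (_ * _); rewrite -[RHS](source_sum0 _ C0 sGC); apply: eq_bigl => A.
  by rewrite JG sGC.
apply: eq_bigr => A sAC; rewrite !ffunE.
have [cA|cA] := boolP (jclosed J A); last first.
  rewrite !mul0r mulr0 big_pred0 // => G; apply/negP => /and4P[/subsetP JG _ /forall_inP inA _].
  case/negP: cA; have JC i : i \in J -> e i \in C -> i \in G.
    by move=> iJ eC; apply: JG; rewrite !inE iJ (jclosedP _ _ _ _ cC) // eC.
  apply: tcyc_jclosed => // i iJ eA; apply: (implyP (inA i _)) => //.
  by apply: JC => //; apply: (subsetP sAC).
have cD : jclosed J (C :\: A) by apply: jclosedD.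
rewrite cD !mul1r.
set S := \sum_(G | tc_between J A G) _.
rewrite [LHS](_ : _ = S * x ^+ #|M A :\: J|); last first.
  by rewrite -(pow_balance tJ cC sAC cA); ring.
rewrite -[x in x ^+ _](subrK 1) [x - 1 + 1]addrC -sum_between_pow.
have dM : [disjoint arcs_in A & M A].
  apply/pred0P => i /=; rewrite !inE; by case: (e i \in A); rewrite ?andbF.
rewrite (big_setU_disjoint _ _ dM); first last.
- by move=> G /andP[].
- by move=> G /and3P[].
have MC : M A \subset arcs_in C by apply/subsetP => i; rewrite inE => /andP[].
have AC := arcs_inS s e sAC.
apply: eq_big => [G|G /and3P[sG oG _]]; last first.
  rewrite /tc_weight -mulrA; congr (_ * _); rewrite -exprD; congr (_ ^+ _).
  rewrite -cardsUI !setDIl [X in (_ + X)%N]eq_card0 ?addn0 => [|i].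
    rewrite -setIUr -setDUl; congr #|pred_of_set _|; apply/setIidPl; exact: setSD.
  by have := pred0P dM i; rewrite !inE /= => /negbT; case: (i \in J) => //= H;
     rewrite andbACA (negPf H) andbF.
apply/and3P/and4P => [[sG /and3P[JA _ tA] /andP[JM _]]|[JG sGC /forall_inP inA tA]].
  split=> //.
  - apply/subsetP => i; rewrite inE => /andP[iJ iC].
    have [iA|iA] := boolP (i \in arcs_in A).
      by have := subsetP JA i; rewrite !in_setI iJ iA => /(_ isT) /andP[].
    suff iM : i \in M A by have := subsetP JM i; rewrite !in_setI iJ iM => /(_ isT) /andP[].
    by rewrite inE iC /=; move: iA; rewrite inE (jclosedP _ _ _ _ cA) // andbb.
  - by apply: subset_trans sG _; rewrite subUset AC.
  apply/forall_inP => i /(subsetP sG); rewrite !inE => /orP[/andP[-> ->] //|].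
  by case/andP=> _ /negPf ->.
split.
- apply/subsetP => i iG; have := subsetP sGC i iG; have := implyP (inA i iG).
  rewrite !inE => eA ->; case: (e i \in A) eA => [->|] //.
  by rewrite andbF.
- apply/and3P; split => //; last exact: subsetIr.
  apply/subsetP => i; rewrite !in_setI => /andP[iJ iA].
  by rewrite iA (subsetP JG) // inE iJ (subsetP AC).
apply/andP; split; last exact: subsetIr.
apply/subsetP => i; rewrite !in_setI => /andP[iJ iA].
by rewrite iA (subsetP JG) // inE iJ (subsetP MC).
Qed.

(** The product of [euler (tc_sum J)] with the inverse of [tc_sum J] is computed twice: with
    [tc_inv_sum J] through [tc_sum_mul], and with [wt_rel J] through [dlog_inv]. *)
Lemma kernel_identity J : tcyc J ->
  \sum_(G : {set I} | (J \subset G) && tcyc G)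
     (-1) ^+ ncomp G setT * (x - 1) ^+ #|G :\: J| * dlog (wt G x^-1) setT =
  - (x^-1 ^+ #|J| * dlog (wt J x) setT).
Proof.
move=> tJ; have Z1 := tc_inv_sumP J; have Z2 := tc_sumP tJ.
have u0 : wt_rel J set0 = 1.
  rewrite !ffunE jclosed0 N0 !mulr1 eq_card0 // => i; by rewrite !inE andbF.
have IE : tc_inv_sum J = wt_rel J.
  by rewrite (sf_invP Z1 (tc_sum0 J)) (sf_invP Z2 (tc_sum0 J)).
have := tc_sum_mul (fun A => #|A|%:R) (jclosedT s e J).
rewrite -/(euler _) IE (dlog_inv (tc_sum0 J) Z2) sf_oppE dlog_scale ?wt0 //.
- rewrite ffunE [X in x^-1 ^+ X](_ : _ = #|J|) => [->|]; last first.
    by apply: eq_card => i; rewrite !inE andbT.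
  apply: eq_big => [G|G _]; first by rewrite /tc_between arcs_inT setIT subsetT.
  rewrite /tc_weight; congr (_ * _); rewrite /dlog sf_mulE; apply: eq_bigr => A _.
  by rewrite eulerE.
- by rewrite eq_card0 // => i; rewrite !inE andbF.
move=> A B dAB; rewrite -exprD -cardsUI [X in (_ + X)%N]eq_card0 ?addn0 => [|i].
  by congr (_ ^+ _); apply: eq_card => i; rewrite !inE andb_orr.
rewrite !inE; have := pred0P dAB (s i); rewrite /=; case: (i \in J) => //=.
Qed.

End Field.
End Kernel.

(** * Polynomiality of the g-polynomials *)

Section Filter.
Context {V : finType} {K : comNzRingType} (P : {set V} -> K -> Prop).
Hypothesis P1 : P set0 1.
Hypothesis P0 : forall A, P A 0.
Hypothesis PD : forall A a b, P A a -> P A b -> P A (a + b).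
Hypothesis PN : forall A a, P A a -> P A (- a).
Hypothesis PM : forall (A B : {set V}) (a b : K), [disjoint A & B] -> P A a -> P B b -> P (A :|: B) (a * b).

Lemma sf_mul_filter (F G : setfun V K) :
  (forall A, P A (F A)) -> (forall A, P A (G A)) -> forall A, P A ((F * G) A).
Proof.
move=> PF PG A; rewrite sf_mulE; apply: big_ind => [|a b|B sBA]; [exact: P0|exact: PD|].
rewrite -{1}(subset_setUD sBA); apply: PM => //.
by rewrite disjoints_subset setCD subsetUr.
Qed.

Lemma sf_inv_filter (F : setfun V K) :
  (forall A, P A (F A)) -> forall A, P A (sf_inv F A).
Proof.
move=> PF A; have [n] := ubnP #|A|; elim: n A => // n IH A leAn.
have [->|A0] := eqVneq A set0; first by rewrite sf_inv0.
rewrite sf_invE //; apply: PN; apply: big_ind => [|a b|B BA]; [exact: P0|exact: PD|].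
rewrite -{1}(subset_setUD (proper_sub BA)) setUC; apply: PM => //.
  by rewrite disjoints_subset subsetDr.
by apply: IH; apply: leq_trans (proper_card BA) _.
Qed.

Lemma dlog_filter (F : setfun V K) :
  (forall A, P A (F A)) -> forall A, P A (dlog F A).
Proof.
move=> PF; apply: sf_mul_filter; last exact: sf_inv_filter.
move=> A; rewrite eulerE; elim: #|A| => [|n IH]; first by rewrite mul0r.
by rewrite -natr1 mulrDl mul1r; apply: PD.
Qed.

End Filter.

Definition map_sf (V : finType) (R S : Type) (f : R -> S) (F : setfun V R) : setfun V S :=
  [ffun A : {set V} => f (F A)].

Lemma map_sf_dlog (V : finType) (R S : comNzRingType) (f : {rmorphism R -> S})
    (F : setfun V R) : F set0 = 1 -> dlog (map_sf f F) = map_sf f (dlog F).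
Proof.
move=> F0; apply/esym/dlog_uniq; first by rewrite ffunE F0 rmorph1.
apply/ffunP => A; rewrite eulerE sf_mulE !ffunE.
have := congr1 (fun G : setfun V R => f (G A)) (euler_dlog F0).
rewrite eulerE rmorphM rmorph_nat sf_mulE rmorph_sum => ->.
by apply: eq_bigr => B _; rewrite rmorphM !ffunE.
Qed.

Lemma dvdp_Xn_coef (R : fieldType) (p : {poly R}) m :
  (forall k, (k < m)%N -> p`_k = 0) -> 'X^m %| p.
Proof.
move=> pk; rewrite -(poly_take_drop m p) (_ : take_poly m p = 0) ?add0r ?dvdp_mull //.
by apply/polyP => k; rewrite coef_take_poly coef0; case: ifP => // /pk.
Qed.

Lemma horner_rev (R : fieldType) (p : {poly R}) d x : (size p <= d.+1)%N -> x != 0 ->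
  (\poly_(i < d.+1) p`_(d - i)).[x] = x ^+ d * p.[x^-1].
Proof.
move=> sp x0; rewrite horner_poly (horner_coef_wide _ sp) (reindex_inj rev_ord_inj) /=.
rewrite big_distrr /=; apply: eq_bigr => i _; have id := ltn_ord i.
have -> : (d - (d.+1 - i.+1) = i)%N by lia.
rewrite subSS mulrCA exprVn; congr (_ * _); apply: (mulIf (expf_neq0 i x0)).
by rewrite -exprD subnK // divfK // expf_neq0.
Qed.

Section Polynomiality.
Context {K : numFieldType} {I V : finType} (s e : I -> V) (N : {set V} -> nat).
Hypothesis card_arcs_in : forall A, #|arcs_in s e A| = (N A).*2.
Hypothesis balanced : forall A B : {set V},
  #|[set i | (s i \in A) && (e i \in B)]| = #|[set i | (s i \in B) && (e i \in A)]|.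
Context (J : {set I}) (tJ : tcyc s e J).

Implicit Types (A B C : {set V}).
Local Notation jclosed := (jclosed s e J).
Local Notation ncomp := (ncomp s e J).
Local Notation comp := (comp s e J).
Local Notation y := ('X - 1 : {poly K}).

Let W : setfun V {poly K} := wt s e N J 'X.
Let W0 : W set0 = 1. Proof. exact: wt0. Qed.
Let L := dlog W.

Definition arcs_from A := #|[set i in J | s i \in A]|.

Lemma arcs_fromU A B : [disjoint A & B] ->
  arcs_from (A :|: B) = (arcs_from A + arcs_from B)%N.
Proof.
move=> dAB; rewrite /arcs_from -cardsUI [X in (_ + X)%N]eq_card0 ?addn0 => [|i].
  by apply: eq_card => i; rewrite !inE andb_orr.
by rewrite !inE; have := pred0P dAB (s i); rewrite /=; case: (i \in J).
Qed.

Lemma arcs_from_le A : jclosed A -> (arcs_from A <= (N A).*2)%N.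
Proof.
move=> /jclosedP cA; rewrite -card_arcs_in; apply/subset_leq_card/subsetP => i.
by rewrite !inE => /andP[iJ sA]; rewrite sA -cA.
Qed.

(** The bounds hold for the monomial ['X^(N A)] with [A] closed, and products over disjoint sets
    keep them: [arcs_from] is additive and [N] is superadditive. The lower bound becomes a degree
    bound after reversal. *)
Lemma dlog_wt_coef A : (L A != 0 -> jclosed A) /\
  forall k, (L A)`_k != 0 -> (arcs_from A <= k.*2)%N && (k <= N A)%N.
Proof.
pose P (A : {set V}) (p : {poly K}) := (p != 0 -> jclosed A) /\
  forall k, p`_k != 0 -> (arcs_from A <= k.*2)%N && (k <= N A)%N.
apply: (@dlog_filter _ _ P) => {A}.
- split=> [_|k]; first exact: jclosed0.
  rewrite coef1; case: k => [|k]; rewrite ?eqxx // => _.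
  by rewrite leqn0 cards_eq0; apply/andP; split=> //; apply/eqP/setP => i; rewrite !inE andbF.
- by move=> A; split=> [|k]; rewrite ?coef0 eqxx.
- move=> A a b [a1 a2] [b1 b2]; split=> [|k].
    have [->|/a1//] := eqVneq a 0; by rewrite add0r.
  rewrite coefD; have [->|/a2//] := eqVneq a`_k 0; rewrite add0r; exact: b2.
- by move=> A a [a1 a2]; split=> [|k]; rewrite ?coefN oppr_eq0 //; exact: a2.
- move=> A B a b dAB [a1 a2] [b1 b2]; split=> [|k].
    by rewrite mulf_eq0 negb_or => /andP[/a1 cA /b1 cB]; apply: jclosedU.
  rewrite coefM => nz.
  have [i ni] : exists i : 'I_k.+1, a`_i * b`_(k - i) != 0.
    apply/existsP; apply: contraR nz; rewrite negb_exists => /forallP H.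
    by rewrite big1 // => i _; apply/eqP; have := H i; rewrite negbK.
  move: ni; rewrite mulf_eq0 negb_or => /andP[/a2 /andP[ai1 ai2] /b2 /andP[bi1 bi2]].
  rewrite arcs_fromU // (N_setU card_arcs_in) //; have := ltn_ord i; lia.
move=> A; rewrite /W ffunE; case: (boolP (jclosed A)) => cA; rewrite ?mul0r ?mul1r; last first.
  by split=> [|k]; rewrite ?coef0 eqxx.
split=> // k; rewrite coefXn; have [-> _|_] := eqVneq k (N A); last by rewrite eqxx.
by rewrite leqnn andbT arcs_from_le.
Qed.

Lemma comp_closed v : jclosed (comp v).
Proof.
apply: tcyc_jclosed => // i iJ; rewrite !inE => /connect_trans; apply.
by rewrite tcyc_sym // arc_connect.
Qed.

Lemma ncomp_comp v : ncomp (comp v) = 1%N.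
Proof.
apply: ncomp1 (comp_closed v) _; first by apply/set0Pn; exists v; apply: mem_comp.
move=> u w; rewrite !inE => vu; apply: connect_trans.
by rewrite tcyc_sym.
Qed.

Let arcs_to v (B : {set V}) := #|[set i | (s i \in comp v) && (e i \in B)]|.

Let arcs_toU v A B : [disjoint A & B] -> arcs_to v (A :|: B) = (arcs_to v A + arcs_to v B)%N.
Proof.
move=> dAB; rewrite /arcs_to -cardsUI [X in (_ + X)%N]eq_card0 ?addn0 => [|i].
  by apply: eq_card => i; rewrite !inE andb_orr.
by rewrite !inE; have := pred0P dAB (e i); rewrite /= andbACA => ->; rewrite andbF.
Qed.

(** Its exponent is the defect of additivity of [N] on [comp v] and [B] in [N_setU]. *)
Let chi v (B : {set V}) : {poly K} := 'X^(arcs_to v B).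
(* The Euler derivation is the sum tc_between v of the derivations
   [F A |-> (v \in A) * F A]; in the term of v only sets containing the component
   of v contribute, and splitting it off leaves M v on the complement. *)
Let M v := sf_scale (chi v) W * sf_inv W.

Let chi0 v : chi v set0 = 1.
Proof.
by rewrite /chi /arcs_to eq_card0 ?expr0 // => i; rewrite !inE andbF.
Qed.

Lemma dlog_wt_pointed A : L A =
  \sum_(v | comp v \subset A) 'X^(N (comp v)) * M v (A :\: comp v).
Proof.
rewrite /L /dlog sf_mulE.
transitivity (\sum_(B : {set V} | B \subset A) \sum_v (v \in B)%:R * (W B * sf_inv W (A :\: B))).
  apply: eq_bigr => B _; rewrite eulerE -mulr_suml mulrA; congr (_ * _ * _).
  by rewrite -natr_sum -sum1_card big_mkcond /=.
rewrite exchange_big [RHS]big_mkcond /=; apply: eq_bigr => v _.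
(* A set containing [v] but not all of [comp v] is not closed, so [W] vanishes there. *)
rewrite (bigID (fun B : {set V} => comp v \subset B)) /= [X in _ + X]big1 ?addr0; last first.
  move=> B /andP[_ nvB]; have [vB|] := boolP (v \in B); last by rewrite mul0r.
  rewrite ffunE; case: (boolP (jclosed B)) => [cB|_]; last by rewrite !mul0r mulr0.
  by rewrite (comp_sub cB vB) in nvB.
case: ifP => vA; last first.
  apply: big_pred0 => B; apply/negP => /andP[sBA svB].
  by rewrite (subset_trans svB sBA) in vA.
rewrite (reindex_onto (fun B => comp v :|: B) (fun B => B :\: comp v)) /=; last first.
  by move=> B /andP[_ /subset_setUD].
rewrite sf_mulE big_distrr /=; apply: eq_big => [B|B /andP[/andP[sB _] /eqP dB]].
  rewrite subsetUl subUset vA setDUl setDv set0U /= andbT subsetD.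
  by congr (_ && _); apply/eqP/idP => /setDidPl.
have dvB : [disjoint comp v & B].
  by rewrite -dB disjoints_subset setCD subsetUr.
rewrite inE mem_comp mul1r !ffunE setDDl mulrA; congr (_ * _).
rewrite (N_setU card_arcs_in balanced dvB) -/(arcs_to v B).
have -> : jclosed (comp v :|: B) = jclosed B.
  apply/idP/idP => [cvB|]; last exact: jclosedU (comp_closed v).
  have := jclosedD (comp_closed v) cvB; rewrite setDUl setDv set0U.
  by move: dvB; rewrite disjoint_sym => /setDidPl ->.
rewrite /chi !exprD; ring.
Qed.

(** The logarithmic derivative of [M v] at B is ([chi v B] - 1) L(B). In #|A| M v A = sum of
    [dlog (M v) B] times [M v (A :\: B)], the first bracket supplies one factor X - 1, L(B) supplies
    c(B) - 1 by [dlog_wt_pointed] and induction, and [M v (A :\: B)] supplies the rest. *)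
Lemma dvdp_pointed_quotient A : jclosed A -> forall v, y ^+ ncomp A %| M v A.
Proof.
have [n] := ubnP #|A|; elim: n A => // n IH A; rewrite ltnS => leAn cA v.
have M0 w : M w set0 = 1 by rewrite sf_mul0 ffunE chi0 W0 sf_inv0 !mulr1.
have [->|A0] := eqVneq A set0; first by rewrite ncomp0 M0 dvdpp.
have nA : (#|A|%:R : K) != 0 by rewrite pnatr_eq0 cards_eq0.
suff: y ^+ ncomp A %| (#|A|%:R : K) *: M v A by rewrite dvdpZr.
have -> : (#|A|%:R : K) *: M v A = euler (M v) A.
  by rewrite eulerE scaler_nat mulr_natl.
have sW0 : sf_scale (chi v) W set0 = 1 by rewrite ffunE chi0 W0 mulr1.
rewrite euler_dlog ?M0 // dlogM ?sf_inv0 // dlog_scale //; last first.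
  by move=> B C dBC; rewrite /chi arcs_toU // exprD.
have -> : dlog (sf_inv W) = - L.
  have -> : L = - dlog (sf_inv W) := dlog_inv W0 (sf_mulV W0).
  by rewrite opprK.
rewrite sf_mulE; apply: (@big_ind _ (fun p => y ^+ ncomp A %| p)); first exact: dvdp0.
  by move=> p q; apply: dvdp_add.
move=> B sBA; rewrite sf_addE sf_oppE ffunE -/L -{2}[L B]mul1r -mulrBl.
have [LB0|/(dlog_wt_coef B).1 cB] := eqVneq (L B) 0; first by rewrite LB0 mulr0 mul0r dvdp0.
have [B0|B0] := eqVneq B set0.
  by rewrite B0 chi0 subrr !mul0r dvdp0.
have cD := jclosedD cB cA.
rewrite (ncompD cB cA sBA) exprD; apply: dvdp_mul; last first.
  apply: IH => //; apply: leq_trans leAn; apply: proper_card.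
  rewrite properE subsetDl; case/set0Pn: B0 => b bB; apply/subsetPn.
  by exists b; [exact: (subsetP sBA)|rewrite inE bB].
have -> : ncomp B = (1 + (ncomp B).-1)%N by rewrite add1n prednK // ncomp_gt0.
rewrite exprD expr1; apply: dvdp_mul; first by rewrite /chi subrX1 dvdp_mulr.
rewrite dlog_wt_pointed.
apply: (@big_ind _ (fun p => y ^+ (ncomp B).-1 %| p)); first exact: dvdp0.
  by move=> p q; apply: dvdp_add.
move=> w wB; apply: dvdp_mull; rewrite (ncompD (comp_closed w) cB wB) ncomp_comp /=.
apply: IH; last exact: jclosedD (comp_closed w) cB.
apply: leq_trans leAn; apply: leq_trans (subset_leq_card sBA); apply: proper_card.
rewrite properE subsetDl; apply/subsetPn; exists w; last by rewrite inE mem_comp.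
exact: (subsetP wB _ (mem_comp s e J w)).
Qed.

Lemma dvdp_dlog_wt : y ^+ (ncomp setT).-1 %| L setT.
Proof.
rewrite dlog_wt_pointed.
apply: (@big_ind _ (fun p => y ^+ (ncomp setT).-1 %| p)); first exact: dvdp0.
  by move=> p q; apply: dvdp_add.
move=> w wB; apply: dvdp_mull; rewrite (ncompD (comp_closed w) (jclosedT s e J) wB).
by rewrite ncomp_comp; apply: dvdp_pointed_quotient; apply: jclosedD (comp_closed w) _; apply: jclosedT.
Qed.


(** With a single component only the empty set and the whole of [V] are closed. *)
Lemma dlog_wt_connected (R : comNzRingType) (z : R) :
  ncomp setT = 1%N -> dlog (wt s e N J z) setT = #|V|%:R * z ^+ N setT.
Proof.
move=> c1; rewrite /dlog sf_mulE (bigD1 setT) //= setDv sf_inv0 mulr1 eulerE cardsT.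
rewrite ffunE jclosedT mul1r big1 ?addr0 // => B /andP[_ BT].
rewrite eulerE ffunE; case: (boolP (jclosed B)) => [cB|_]; last by rewrite mul0r mulr0 mul0r.
have [->|B0] := eqVneq B set0; first by rewrite cards0 !mul0r.
have := ncompD cB (jclosedT s e J) (subsetT B); rewrite c1.
have : (0 < ncomp B)%N by apply: ncomp_gt0.
have : (0 < ncomp (setT :\: B))%N.
  apply: ncomp_gt0; apply: contra BT => /eqP D0; rewrite eqEsubset subsetT /=.
  by rewrite -setD_eq0 D0.
lia.
Qed.

Lemma dlog_wt_eval (x : K) A : dlog (wt s e N J x) A = (L A).[x].
Proof.
rewrite (_ : wt s e N J x = map_sf (horner_eval x) W) ?map_sf_dlog ?W0 ?ffunE //.
apply/ffunP => B; rewrite !ffunE.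
by rewrite rmorphM rmorph_nat rmorphXn /= /horner_eval hornerX.
Qed.

(** With n = N(V), c = c(J) and L(V) = (X - 1)^(c-1) q, one has x^n L(V)(1/x) = (1 - x)^(c-1)
    x^(n-c+1) q(1/x), so g is q reversed in degree n - c + 1, divided by |V|. The size bound says
    deg g <= dim F_J / 2. *)
Lemma gale_g_poly : (0 < #|V|)%N -> exists2 g : {poly K},
  (size g <= ((N setT).*2 - #|J| - ncomp setT)./2.+1)%N &
  forall x, x != 0 -> #|V|%:R * g.[x] * (1 - x) ^+ (ncomp setT).-1 =
    x ^+ N setT * dlog (wt s e N J x^-1) setT.
Proof.
move=> V0; set c := ncomp setT; set n := N setT.
have nV : (#|V|%:R : K) != 0 by rewrite pnatr_eq0 -lt0n.
have c0 : (0 < c)%N by apply: ncomp_gt0; rewrite -card_gt0 cardsT.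
(* The general estimate deg g <= n - c + 1 - ceil(|J|/2) meets the bound only for c >= 2; for c = 1
   and |J| even it is too weak by one, but there g = 1 outright. *)
have [c1|c1] := eqVneq c 1%N.
  exists 1 => [|x x0]; first by rewrite size_poly1.
  rewrite dlog_wt_connected // c1 expr0 hornerC !mulr1 mulrCA -exprMn divff //.
  by rewrite expr1n mulr1.
set m := uphalf #|J|.
have Lcoef k : (L setT)`_k != 0 -> (m <= k <= n)%N.
  move=> /(dlog_wt_coef setT).2; rewrite /arcs_from (_ : [set i in J | _] = J) /m; last first.
    by apply/setP => i; rewrite !inE andbT.
  by rewrite /n => /andP[? ->]; rewrite andbT; lia.
have [q Lq] : exists q, L setT = y ^+ c.-1 * q.
  by have /dvdpP[q ->] := dvdp_dlog_wt; exists q; rewrite mulrC.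
have y0 : y ^+ c.-1 != 0 by rewrite expf_neq0 // -size_poly_eq0 size_XsubC.
have qm k : (k < m)%N -> q`_k = 0.
  have : 'X^m %| L setT.
    apply: dvdp_Xn_coef => k' km; apply/eqP; apply: contraTT km => /Lcoef /andP[].
    by rewrite -leqNgt.
  (* X is coprime to X - 1, so the vanishing of the low coefficients passes from L(V) to q. *)
  rewrite Lq Gauss_dvdpr; last first.
    apply: coprimep_expl; apply: coprimep_expr.
    have := @coprimep_XsubC2 _ (0 : K) 1; rewrite polyC0 polyC1 !subr0.
    by apply; rewrite oner_eq0.
  by case/dvdpP => q' -> km; rewrite coefMXn km.
have sq : (size q <= n.+1 - c.-1)%N.
  have [->|q0] := eqVneq q 0; first by rewrite size_poly0.
  have : (size (L setT) <= n.+1)%N.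
    apply/leq_sizeP => k kn; apply/eqP; apply: contraTT kn => /Lcoef /andP[_].
    by rewrite -leqNgt.
  by rewrite Lq size_mul // size_exp_XsubC addSn /= => /(leq_sub2r c.-1); rewrite addKn.
set d := (n.+1 - c.-1)%N in sq *.
(* The truncated difference [d] is 0 when c - 1 > n; then the size bound forces q = 0, and g = 0
   works. *)
have [d0|d0] := posnP d.
  have q0 : q = 0 by apply/eqP; rewrite -size_poly_leq0 -d0.
  exists 0 => [|x x0]; first by rewrite size_poly0.
  by rewrite horner0 mulr0 mul0r dlog_wt_eval Lq q0 mulr0 horner0 mulr0.
rewrite -(prednK d0) in sq.
exists ((#|V|%:R : K)^-1 *: \poly_(j < d.-1.+1) q`_(d.-1 - j)).
  apply: leq_trans (size_scale_leq _ _) _; apply/leq_sizeP => k kD.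
  rewrite coef_poly; case: ifP => // kd; apply: qm.
  by move: kD kd; rewrite /d /m /n; lia.
move=> x x0; rewrite hornerZ mulrA divff // mul1r.
rewrite horner_rev // dlog_wt_eval Lq hornerM horner_exp hornerD hornerX hornerN hornerC.
have -> : n = (d.-1 + c.-1)%N by move: d0; rewrite /d; lia.
rewrite exprD -!mulrA [x ^+ c.-1 * _]mulrA -exprMn mulrBr divff // mulr1.
by rewrite [q.[_] * _]mulrC.
Qed.

End Polynomiality.

(** * Faces of the Gale dual polytope *)

Lemma scale_regE (K : pzRingType) (a b : K) : a *: (b : K^o) = a * b.
Proof. by []. Qed.

Section LinearAlgebra.
Context {K : fieldType}.

Lemma lfun_of_linear (aT rT : vectType K) (f : aT -> rT) : linear f ->
  exists g : 'Hom(aT, rT), forall x, g x = f x.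
Proof.
move=> fL; pose f' : {linear aT -> rT} := HB.pack f (GRing.isLinear.Build _ _ _ _ f fL).
by exists (linfun f') => x; rewrite lfunE.
Qed.

Lemma lfun_factor (aT rT : vectType K) (f : 'Hom(aT, rT)) (h : 'Hom(aT, K^o)) :
  (forall x, f x = 0 -> h x = 0) -> exists g : 'Hom(rT, K^o), forall x, h x = g (f x).
Proof.
move=> fh; exists (h \o f^-1)%VF => x; rewrite comp_lfunE.
have : h (x - (f^-1)%VF (f x)) = 0.
  by apply: fh; rewrite linearB /= limg_lfunVK ?subrr // memv_img ?memvf.
by rewrite linearB /= => /subr0_eq.
Qed.

Lemma exists_free_span (vT : vectType K) (X : seq vT) :
  exists2 Y : seq vT, {subset Y <= X} & free Y /\ <<Y>>%VS = <<X>>%VS.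
Proof.
elim: X => [|x X [Y sYX [fY YX]]]; first by exists [::]; rewrite ?nil_free.
have [xX|xX] := boolP (x \in <<X>>%VS).
  exists Y => [y /sYX yX|]; first by rewrite inE yX orbT.
  split=> //; rewrite span_cons YX; apply/esym/addv_idPr.
  by rewrite -memvE.
exists (x :: Y) => [y|]; first by rewrite !inE => /orP[->|/sYX ->]; rewrite ?orbT.
by rewrite free_cons YX xX !span_cons YX.
Qed.

End LinearAlgebra.

(** On the hyperplane l = 1 affine and linear independence agree: the differences span a subspace of
    [lker l], which misses [x]. *)
Lemma aff_free_free (R : realType) (W : vectType R) (l : 'Hom(W, R^o)) (s : seq W) :
  (forall x, x \in s -> l x = 1) -> aff_free s = free s.
Proof.
case: s => [|x s] ls; first by rewrite nil_free.
have lx : l x = 1 by apply: ls; rewrite mem_head.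
set s' := [seq y - x | y <- s].
have s'0 : (<<s'>> <= lker l)%VS.
  apply/span_subvP => _ /mapP[y ys ->]; rewrite memv_ker linearB /= lx ls ?subrr //.
  by rewrite inE ys orbT.
have xs' : x \notin <<s'>>%VS.
  by apply/negP => /(subvP s'0); rewrite memv_ker lx oner_eq0.
have E : <<x :: s>>%VS = <<x :: s'>>%VS.
  apply/eqP; rewrite eqEsubv !span_cons; apply/andP; split.
    rewrite subv_add addvSl /=; apply/span_subvP => y ys.
    rewrite -[y](subrK x) addrC; apply: memv_add; first exact: memv_line.
    by apply/memv_span/map_f.
  rewrite subv_add addvSl /=; apply/span_subvP => _ /mapP[y ys ->].
  by rewrite addrC -scaleN1r; apply: memv_add; rewrite ?memvZ ?memv_line ?memv_span.
have -> : free (x :: s) = free (x :: s') by rewrite /free E /= size_map.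
by rewrite free_cons xs'.
Qed.

Section GaleFaces.
Context {R : realType} {V : finType} (A : seq {ffun V -> R^o}).
Local Notation I := 'I_(size A).
Context (s e : I -> V).
Hypothesis arcE : forall i : I, A`_i = root_vec R (s i) (e i).
Hypothesis bal1 : forall v, #|[set i | s i == v]| = #|[set i | e i == v]|.
Hypothesis conn : forall u v, connect (arc_rel s e [set: I]) u v.

Implicit Types (J : {set I}) (m : 'rV[R]_(size A)).
Local Notation beta := (@gale_vec R _ A).
Local Notation tcyc := (tcyc s e).

Definition gface J : gale_space A -> Prop := fun x =>
  exists a : I -> R, [/\ forall i, 0 <= a i, \sum_i a i = 1,
    forall i, i \in J -> a i = 0 & x = \sum_i a i *: beta i].

Lemma gface0 : gale_polytope A = gface finset.set0.
Proof.
apply: funext => x; apply: propext; split=> [[a [a0 a1 ->]]|[a [a0 a1 _ ->]]].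
  by exists a; split=> // i; rewrite inE.
by exists a; split.
Qed.

(** Coordinate [v] of the combination is outflow minus inflow at [v], so relations are
    circulations. *)
Lemma relationsP m :
  reflect (forall v, \sum_(i | s i == v) m 0 i = \sum_(i | e i == v) m 0 i)
          (m \in relations A).
Proof.
have E v : (\sum_i m 0 i *: A`_i) v =
    \sum_(i | s i == v) m 0 i - \sum_(i | e i == v) m 0 i.
  rewrite sum_ffunE [X in _ = X - _]big_mkcond [X in _ = _ - X]big_mkcond -sumrB.
  apply: eq_bigr => i _; rewrite !ffunE arcE ffunE scale_regE mulrBr.
  rewrite ![v == _]eq_sym; congr (_ - _); case: (_ == _); by rewrite ?mulr1 ?mulr0.
rewrite mem_relations; apply: (iffP eqP) => [m0 v|mE].
  by apply/eqP; rewrite -subr_eq0 -E m0 ffunE.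
by apply/ffunP => v; rewrite E mE subrr ffunE.
Qed.

Lemma gale_eval m : m \in relations A ->
  exists l : 'Hom(gale_space A, R^o), forall i, l (beta i) = m 0 i.
Proof.
move=> mA; have [|l lE] := @lfun_of_linear R (gale_space A) R^o
    (fun f : gale_space A => f (vsproj (relations A) m)).
  by move=> a f g; rewrite add_lfunE scale_lfunE.
by exists l => i; rewrite lE gale_vecE vsprojK.
Qed.

(** The sum over i of ([s i = v] - [e i = v]) beta_i is zero, since it vanishes at every
    circulation; applying [l] to it gives Kirchhoff's law at [v]. *)
Lemma gale_lfun (l : 'Hom(gale_space A, R^o)) :
  \row_i l (beta i) \in relations A.
Proof.
apply/relationsP => v; apply/eqP; rewrite -subr_eq0 [X in X - _]big_mkcond.
rewrite [X in _ - X]big_mkcond -sumrB /=.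
rewrite (_ : \sum_i _ = l (\sum_i ((s i == v)%:R - (e i == v)%:R : R) *: beta i)).
  rewrite (_ : \sum_i _ = 0) ?linear0 //; apply/lfunP => m.
  rewrite sum_lfunE lfunE /=.
  transitivity (\sum_(i | s i == v) vsval m 0 i - \sum_(i | e i == v) vsval m 0 i).
    rewrite [X in _ = X - _]big_mkcond [X in _ = _ - X]big_mkcond -sumrB /=.
    apply: eq_bigr => i _; rewrite scale_lfunE gale_vecE scale_regE mulrBl.
    by congr (_ - _); case: (_ == _); rewrite ?mul1r ?mul0r.
  by have /relationsP -> := valP m; rewrite subrr.
rewrite linear_sum; apply: eq_bigr => i _; rewrite linearZ /= !mxE scale_regE mulrBl.
by congr (_ - _); case: (_ == _); rewrite ?mul1r ?mul0r.
Qed.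

(** The corresponding functional is 1 at every beta_i. It homogenizes the inequalities of faces and
    turns affine dimension into linear dimension. *)
Lemma const1_relations : const_mx 1 \in relations A.
Proof.
apply/relationsP => v; under eq_bigr do rewrite mxE; under [RHS]eq_bigr do rewrite mxE.
rewrite !sumr_const; congr (_ *+ _).
by have := bal1 v; rewrite !cardsE.
Qed.

Lemma path_flow J u v : connect (arc_rel s e J) u v -> exists y : I -> R,
  [/\ forall i, 0 <= y i, forall i, i \notin J -> y i = 0 &
      forall w, \sum_(i | s i == w) y i + (w == v)%:R = \sum_(i | e i == w) y i + (w == u)%:R].
Proof.
case/connectP => p; elim: p u => [|w p IH] u /=.
  move=> _ ->; exists (fun=> 0); split=> // w.
  by rewrite !big1.
case/andP => /arc_relP[j [jJ <- <-]] /IH{}IH /IH[y [y0 yJ yE]].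
exists (fun i => y i + (i == j)%:R); split=> [i|i iJ|z].
- by rewrite addr_ge0.
- by rewrite yJ // add0r (negPf (contraNneq _ iJ)) // => ->.
rewrite !big_split /= -addrA [_ + (z == v)%:R]addrC addrA yE.
have delta (f : I -> V) : \sum_(i | f i == z) (i == j)%:R = (z == f j)%:R :> R.
  rewrite big_mkcond (bigD1 j) //= eqxx big1 ?addr0 => [|i /negPf ->]; last by case: ifP.
  by rewrite eq_sym; case: (_ == _).
rewrite !delta; ring.
Qed.

(** Each arc of [J] is closed to a cycle inside [J] by a path from its head to its tail; the unit
    flows along these cycles are added up. *)
Lemma tcyc_circulation J : tcyc J ->
  exists2 m, m \in relations A & forall i, 0 <= m 0 i /\ (m 0 i != 0) = (i \in J).
Proof.
move=> tJ.
have H j : {y : I -> R | j \in J -> [/\ forall i, 0 <= y i, forall i, i \notin J -> y i = 0,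
   0 < y j & forall w, \sum_(i | s i == w) y i = \sum_(i | e i == w) y i]}.
  apply: cid; have [jJ|] := boolP (j \in J); last by move=> _; exists (fun=> 0).
  have [y [y0 yJ yE]] := path_flow (tcycP _ _ _ tJ j jJ).
  exists (fun i => y i + (i == j)%:R) => _; split=> [i|i iJ||w].
  - by rewrite addr_ge0.
  - by rewrite yJ // add0r (negPf (contraNneq _ iJ)) // => ->.
  - by rewrite eqxx ltr_wpDl.
  rewrite !big_split /=.
  have delta (f : I -> V) : \sum_(i | f i == w) (i == j)%:R = (w == f j)%:R :> R.
    rewrite big_mkcond (bigD1 j) //= eqxx big1 ?addr0 => [|i /negPf ->]; last by case: ifP.
    by rewrite eq_sym; case: (_ == _).
  by rewrite !delta yE.
pose Y j := sval (H j); have YP j := svalP (H j); rewrite -/(Y _) in YP.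
exists (\row_i \sum_(j in J) Y j i) => [|i].
  apply/relationsP => w; under eq_bigr do rewrite mxE; under [RHS]eq_bigr do rewrite mxE.
  rewrite exchange_big [RHS]exchange_big /=; apply: eq_bigr => j jJ.
  by have [_ _ _ ->] := YP j jJ.
rewrite mxE; have Y0 j : j \in J -> 0 <= Y j i by move=> /YP[y0 *]; apply: y0.
split; first exact: sumr_ge0.
have [iJ|iJ] := boolP (i \in J).
  rewrite (bigD1 i) //= gt_eqF // ltr_pwDl //; first by have [] := YP i iJ.
  by apply: sumr_ge0 => j /andP[/Y0].
by rewrite big1 ?eqxx // => j /YP[_ nz _ _]; apply: nz.
Qed.

(** Let X be the set reached from the head of an arc in the support. No flow leaves X, so by
    conservation none enters, and the tail of the arc is in X as well. *)
Lemma circulation_tcyc m : m \in relations A -> (forall i, 0 <= m 0 i) ->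
  tcyc [set i | m 0 i != 0].
Proof.
move=> /relationsP mA m0; set J := finset _; apply/tcycP => i iJ.
pose X := [set w | connect (arc_rel s e J) (e i) w].
have outX j : j \in J -> s j \in X -> e j \in X.
  by move=> jJ; rewrite !inE => /connect_trans; apply; apply: arc_connect.
have : \sum_(j | s j \in X) m 0 j = \sum_(j | e j \in X) m 0 j.
  rewrite (partition_big s (mem X)) // [RHS](partition_big e (mem X)) //=.
  apply: eq_bigr => w wX; have {}wX : w \in X by [].
  transitivity (\sum_(j | s j == w) m 0 j).
    by apply: eq_bigl => j; case: eqP => [->|]; rewrite ?wX ?andbF.
  by rewrite mA; apply: eq_bigl => j; case: eqP => [->|]; rewrite ?wX ?andbF.
rewrite (bigID (fun j => e j \in X)) /= [X in _ + X = _]big1 ?addr0; last first.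
  move=> j /andP[sX eX]; apply/eqP; apply: contraNT eX => mj.
  by apply: outX; rewrite // inE.
rewrite [RHS](bigID (fun j => s j \in X)) /= => /eqP.
rewrite (eq_bigl (fun j => (e j \in X) && (s j \in X))) => [|j]; last by rewrite andbC.
rewrite -{1}[X in X == _]addr0 (inj_eq (addrI _)) eq_sym psumr_eq0 // => /allP/(_ i).
rewrite mem_index_enum => /(_ isT) /implyP.
have -> : e i \in X by rewrite inE connect0.
case: (boolP (s i \in X)) => [|_ /(_ isT)]; first by rewrite inE.
by move: iJ; rewrite inE => /negPf ->.
Qed.

(** A valid inequality [l <= c] yields the circulation with entries c - l(beta_i). Its face is where
    the weights vanish on the support, once this circulation is made nonnegative. *)
Lemma gfaceP J F : tcyc J ->
  is_face (gface J) F <-> exists J', [/\ tcyc J', J \subset J' & F = gface J'].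
Proof.
move=> tJ; split=> [[l [c [lc ->]]]|[J' [tJ' sJJ' ->]]].
  have [mJ mJA mJP] := tcyc_circulation tJ.
  pose m : 'rV[R]_(size A) := c *: const_mx 1 - \row_i l (beta i).
  have mE i : m 0 i = c - l (beta i) by rewrite !mxE mulr1.
  have mA : m \in relations A.
    by apply: rpredB; [apply/rpredZ/const1_relations|apply: gale_lfun].
  have m0 i : i \notin J -> 0 <= m 0 i.
    move=> iJ; rewrite mE subr_ge0; apply: lc; exists (fun j => (j == i)%:R); split=> //.
    - by rewrite (bigD1 i) //= eqxx big1 ?addr0 // => j /negPf ->.
    - by move=> j jJ; rewrite (negPf (contraNneq _ iJ)) // => <-.
    rewrite (bigD1 i) //= eqxx scale1r big1 ?addr0 // => j /negPf ->.
    by rewrite scale0r.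
  (* The circulation [m] is nonnegative only off [J]. Adding a multiple of [mJ], supported on [J],
     changes nothing on [gface J], where the weights on [J] are zero; this [t] is large enough to
     make every entry on [J] positive. *)
  pose t := 1 + \sum_(i in J) `|m 0 i| / mJ 0 i.
  pose m' := m + t *: mJ.
  have m'A : m' \in relations A by apply: rpredD => //; apply: rpredZ.
  have m'E i : m' 0 i = m 0 i + t * mJ 0 i by rewrite [LHS]mxE [X in _ + X]mxE.
  have m'J i : i \in J -> 0 < m' 0 i.
    move=> iJ; rewrite m'E.
    have mJi : 0 < mJ 0 i by have [? mi] := mJP i; rewrite lt_neqAle eq_sym mi iJ.
    have : `|m 0 i| / mJ 0 i < t.
      rewrite /t (bigD1 i) //= addrCA ltrDl ltr_pwDl //.
      by apply: sumr_ge0 => j _; apply: divr_ge0 => //; case: (mJP j).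
    rewrite ltr_pdivrMr // => H; have := ler_norm (- m 0 i); rewrite normrN; lra.
  have m'nJ i : i \notin J -> m' 0 i = m 0 i.
    move=> iJ; have [_] := mJP i; rewrite (negPf iJ) => /negbFE/eqP mi.
    by rewrite m'E mi mulr0 addr0.
  have m'0 i : 0 <= m' 0 i.
    by have [/m'J/ltW //|iJ] := boolP (i \in J); rewrite m'nJ ?m0.
  exists [set i | m' 0 i != 0]; split; first exact: circulation_tcyc.
    by apply/subsetP => i /m'J; rewrite inE => /lt0r_neq0.
  have lE (a : I -> R) : \sum_i a i = 1 -> (forall i, i \in J -> a i = 0) ->
      l (\sum_i a i *: beta i) = c - \sum_i a i * m' 0 i.
    move=> a1 aJ; rewrite linear_sum -[c]mul1r -a1 mulr_suml -sumrB; apply: eq_bigr => i _.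
    rewrite linearZ /= -[_ *: _]/(a i * _).
    have [/aJ ->|iJ] := boolP (i \in J); first by rewrite !mul0r subr0.
    by rewrite m'nJ // mE; ring.
  apply: funext => x; apply: propext; split.
    case=> -[a [a0 a1 aJ ->]]; rewrite lE // => /eqP.
    rewrite -subr_eq0 addrAC subrr sub0r oppr_eq0 psumr_eq0 => [/allP am|i _]; last exact: mulr_ge0.
    exists a; split=> // i; rewrite inE => mi.
    by have := am i (mem_index_enum i); rewrite /= mulf_eq0 (negPf mi) orbF => /eqP.
  case=> a [a0 a1 aJ' ->].
  have aJ i : i \in J -> a i = 0 by move=> /m'J/lt0r_neq0 mi; apply: aJ'; rewrite inE.
  split; first by exists a.
  rewrite lE // big1 ?subr0 // => i _; have [->|mi] := eqVneq (m' 0 i) 0; first by rewrite mulr0.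
  by rewrite aJ' ?mul0r // inE.
have [m mA mP] := tcyc_circulation tJ'; have [l lE] := gale_eval mA.
have lsum (a : I -> R) : (- l) (\sum_i a i *: beta i) = - \sum_i a i * m 0 i.
  rewrite opp_lfunE linear_sum; congr (- _); apply: eq_bigr => i _.
  by rewrite linearZ /= lE.
have am0 (a : I -> R) i : (forall i, 0 <= a i) -> 0 <= a i * m 0 i.
  by move=> a0; apply: mulr_ge0 => //; case: (mP i).
exists (- l), 0; split=> [_ [a [a0 _ _ ->]]|].
  by rewrite lsum oppr_le0; apply: sumr_ge0 => i _; apply: am0.
apply: funext => x; apply: propext; split.
  case=> a [a0 a1 aJ' ->]; split.
    by exists a; split=> // i iJ; apply: aJ'; apply: (subsetP sJJ').
  rewrite lsum big1 ?oppr0 // => i _; have [_ mi] := mP i.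
  by have [/aJ' ->|iJ'] := boolP (i \in J'); rewrite ?mul0r //;
     move: mi; rewrite (negPf iJ') => /negbFE/eqP ->; rewrite mulr0.
case=> -[a [a0 a1 _ ->]]; rewrite lsum => /eqP; rewrite oppr_eq0 psumr_eq0 => [/allP am|i _]; last exact: am0.
exists a; split=> // i iJ'; have [_ mi] := mP i.
by have := am i (mem_index_enum i); rewrite /= mulf_eq0 (negPf (_ : m 0 i != 0)) ?mi // orbF => /eqP.
Qed.

(** The functional of a circulation with support [J2] vanishes on [gface J2], and at beta_i it
    vanishes only for i outside [J2]. *)
Lemma gface_sub J1 J2 : tcyc J2 -> gface J1 = gface J2 -> J2 \subset J1.
Proof.
move=> tJ E; have [m mA mP] := tcyc_circulation tJ; have [l lE] := gale_eval mA.
apply/subsetP => i; apply: contraLR => iJ1.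
have : gface J1 (beta i).
  exists (fun j => (j == i)%:R); split=> //.
  - by rewrite (bigD1 i) //= eqxx big1 ?addr0 // => j /negPf ->.
  - by move=> j jJ; rewrite (negPf (contraNneq _ iJ1)) // => <-.
  rewrite (bigD1 i) //= eqxx scale1r big1 ?addr0 // => j /negPf ->.
  by rewrite scale0r.
rewrite E => -[a [_ _ aJ /(congr1 l)]]; rewrite lE linear_sum.
rewrite big1 => [mi|j _]; first by have [_ <-] := mP i; rewrite mi eqxx.
rewrite linearZ /= lE; have [_ mj] := mP j.
have [/aJ ->|jJ] := boolP (j \in J2); first by rewrite scale0r.
by move: mj; rewrite (negPf jJ) => /negbFE/eqP ->; rewrite scaler0.
Qed.

Lemma gface_inj J1 J2 : tcyc J1 -> tcyc J2 -> gface J1 = gface J2 -> J1 = J2.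
Proof.
by move=> t1 t2 E; apply/eqP; rewrite eqEsubset !gface_sub.
Qed.


(** * Potentials, coboundaries and the dimension of a face *)

Lemma coboundary_orth (phi : V -> R) m : m \in relations A ->
  \sum_i (phi (s i) - phi (e i)) * m 0 i = 0.
Proof.
move=> /relationsP mA.
have E (f : I -> V) : \sum_i phi (f i) * m 0 i = \sum_v phi v * \sum_(i | f i == v) m 0 i.
  rewrite (partition_big f predT) //=; apply: eq_bigr => v _.
  by rewrite big_distrr /=; apply: eq_bigr => i /eqP ->.
under eq_bigr do rewrite mulrBl; rewrite sumrB !E; apply/eqP; rewrite subr_eq0; apply/eqP.
by apply: eq_bigr => v _; rewrite mA.
Qed.

(** Pairing with [y] kills the kernel of [lin_comb], hence factors through it; the potential is the
    factoring functional on the standard basis. *)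
Lemma orth_coboundary (y : I -> R) :
  (forall m, m \in relations A -> \sum_i y i * m 0 i = 0) ->
  exists phi : V -> R, forall i, y i = phi (s i) - phi (e i).
Proof.
move=> yA.
have [|h hE] := @lfun_of_linear R 'rV[R]_(size A) R^o (fun m => \sum_i y i * m 0 i).
  move=> a m1 m2; rewrite scale_regE big_distrr -big_split /=; apply: eq_bigr => i _.
  by rewrite !mxE; ring.
have [|g gE] := lfun_factor (f := linfun (@lin_comb R _ A)) (h := h).
  move=> m; rewrite lfunE /= => m0; rewrite hE; apply: yA.
  by rewrite mem_relations; apply/eqP.
pose eps v : {ffun V -> R^o} := [ffun w => (w == v)%:R].
exists (fun v => g (eps v)) => i.
have := gE (delta_mx 0 i); rewrite hE lfunE /= /lin_comb.
rewrite (bigD1 i) //= !mxE !eqxx mulr1 big1 ?addr0 => [|j /negPf ji]; last first.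
  by rewrite mxE ji andbF mulr0.
move=> ->; rewrite (bigD1 i) //= !mxE !eqxx scale1r big1 ?addr0 => [|j /negPf ji]; last first.
  by rewrite mxE ji andbF scale0r.
rewrite arcE (_ : root_vec R _ _ = eps (s i) - eps (e i)) ?linearB //.
by apply/ffunP => v; rewrite !ffunE.
Qed.

Definition gface_comb J (y : {ffun I -> R^o}) : gale_space A :=
  \sum_(i | i \notin J) y i *: beta i.

Lemma gface_comb_linear J : linear (gface_comb J).
Proof.
move=> a y z; rewrite /gface_comb scaler_sumr -big_split; apply: eq_bigr => i _.
by rewrite !ffunE scalerDl scalerA.
Qed.

Lemma gface_comb_eq0 J y : tcyc J -> gface_comb J y = 0 <->
  exists phi : V -> R, forall i, (if i \in J then 0 else y i) = phi (s i) - phi (e i).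
Proof.
move=> tJ; split=> [y0|[phi yE]].
  apply: orth_coboundary => m mA; have [l lE] := gale_eval mA.
  have := congr1 l y0; rewrite linear0 linear_sum => l0; rewrite -[RHS]l0 [RHS]big_mkcond.
  by apply: eq_bigr => i _; case: (i \in J); rewrite /= ?mul0r // linearZ /= lE.
apply/lfunP => m; rewrite sum_lfunE lfunE /=.
rewrite -[RHS](coboundary_orth phi (valP m)) [LHS]big_mkcond; apply: eq_bigr => i _.
by rewrite -yE; case: (i \in J); rewrite /= ?mul0r // scale_lfunE gale_vecE.
Qed.

(** In the kernel of [T] the entries on [J] are free, and the others are the coboundary of a
    potential constant on the components of [J]. Normalizing the potential to 0 on the component of
    [v0] leaves c(J) - 1 values, so [D] indexes coordinates of the kernel; [conn] makes them
    independent. *)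
Lemma dim_gface_comb J (T : 'Hom({ffun I -> R^o}, gale_space A)) : tcyc J ->
  (0 < #|V|)%N -> (forall y, T y = gface_comb J y) ->
  (\dim (limg T) + (#|J| + (ncomp s e J setT).-1))%N = size A.
Proof.
move=> tJ /card_gt0P[v0 _] TE.
pose Cl := [set comp s e J v | v in [set: V]].
pose D : {set I + {set V}} := [set inl i | i in J] :|: [set inr X | X in Cl :\ comp s e J v0].
have cardD : #|D| = (#|J| + (ncomp s e J setT).-1)%N.
  rewrite cardsU disjoint_setI0 ?cards0 ?subn0; last first.
    apply/pred0P => d /=; apply/negP => /andP[/imsetP[i _ ->] /imsetP[X _]]//.
  rewrite !card_imset; [|by move=> ? ? []|by move=> ? ? []].
  congr addn; rewrite /ncomp (cardsD1 (comp s e J v0) Cl) (imset_f _ (in_setT v0)).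
  by [].
pose K := {ffun {d | d \in D} -> R^o}.
pose ext (z : K) d : R := if insub d is Some u then z u else 0.
have extL d a z w : ext (a *: z + w) d = a * ext z d + ext w d.
  by rewrite /ext; case: insub => [u|]; rewrite ?ffunE ?mulr0 ?addr0.
pose phi (z : K) v := ext z (inr (comp s e J v)).
have [|T' T'E] := @lfun_of_linear R K {ffun I -> R^o}
    (fun z => [ffun i => if i \in J then ext z (inl i) else phi z (s i) - phi z (e i)]).
  move=> a z w; apply/ffunP => i; rewrite !ffunE /phi !extL.
  by case: ifP => _ //; rewrite scale_regE; ring.
have phi0 z : phi z v0 = 0.
  rewrite /phi /ext insubF //; apply/negP; rewrite inE => /orP[] /imsetP[] // X.
  by rewrite !inE => /andP[/eqP nX _] [/esym].
have phiJ z i : i \in J -> phi z (s i) = phi z (e i).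
  move=> iJ; rewrite /phi; congr (ext _ (inr _)); apply/setP => u; rewrite !inE.
  apply/idP/idP; apply: connect_trans; last exact: arc_connect.
  exact: (tcycP _ _ _ tJ i iJ).
have kerT' : lker T' == 0%VS.
  apply/lker0P => z w; move/eqP; rewrite -subr_eq0 -linearB /= => /eqP.
  set x := z - w => Tx0; apply/eqP; rewrite -subr_eq0; apply/eqP/ffunP => -[d dD].
  rewrite -/x [RHS]ffunE.
  have T0 i : (if i \in J then ext x (inl i) else phi x (s i) - phi x (e i)) = 0.
    by have /ffunP/(_ i) := Tx0; rewrite T'E !ffunE.
  have phx v : phi x v = 0.
    have cl : {in [set: I], forall i, s i \in [set w | phi x w == 0] ->
        e i \in [set w | phi x w == 0]}.
      move=> i _; rewrite !inE => /eqP ps; have := T0 i; case: ifP => [/(phiJ x) <-|_].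
        by rewrite ps.
      by rewrite ps sub0r => /eqP; rewrite oppr_eq0.
    have := connect_fwd cl (conn v0 v); rewrite !inE phi0 eqxx => /(_ isT); exact: eqP.
  have -> : x (exist _ d dD) = ext x d.
    by rewrite /ext insubT.
  have := dD; rewrite inE => /orP[] /imsetP[].
    by move=> i iJ ->; have := T0 i; rewrite iJ.
  by move=> X; rewrite inE => /andP[_ /imsetP[v _ ->]] ->; apply: phx.
have imT' : limg T' = lker T.
  apply/vspaceP => y; apply/memv_imgP/idP => [[z _ ->]|].
    rewrite memv_ker TE; apply/eqP/gface_comb_eq0 => //; exists (phi z) => i.
    rewrite T'E ffunE; have [iJ|iJ] := boolP (i \in J); last by [].
    by rewrite (phiJ z i iJ) subrr.
  rewrite memv_ker TE => /eqP/gface_comb_eq0 -/(_ tJ) [psi psiE].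
  have psiC u v : comp s e J u = comp s e J v -> psi u = psi v.
    move=> uv; have: v \in comp s e J u by rewrite uv mem_comp.
    rewrite inE => cuv; have : v \in [set w | psi w == psi u].
      apply: connect_fwd cuv _; last by rewrite inE.
      move=> i iJ; rewrite !inE => /eqP <-; have := psiE i; rewrite iJ => /esym/eqP.
      by rewrite subr_eq0 eq_sym.
    by rewrite inE => /eqP.
  pose psi' v := psi v - psi v0.
  pose z : K := finfun (fun u : {d | d \in D} => (match val u with
    | inl i => y i
    | inr X => if [pick v | comp s e J v == X] is Some v then psi' v else 0 end) : R^o).
  exists z; first exact: memvf.
  have phz v : phi z v = psi' v.
    have [vv0|vv0] := eqVneq (comp s e J v) (comp s e J v0).
      by rewrite /psi' (psiC _ _ vv0) subrr -(phi0 z) /phi vv0.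
    rewrite /phi /ext; have dD : inr (comp s e J v) \in D.
      by rewrite inE; apply/orP; right; apply: imset_f; rewrite !inE vv0; apply: imset_f.
    rewrite insubT ffunE /=; case: pickP => [w /eqP /psiC|/(_ v)]; last by rewrite eqxx.
    by rewrite /psi' => ->.
  apply/ffunP => i; rewrite T'E ffunE; have := psiE i; case: ifP => iJ pE.
    have dD : inl i \in D by rewrite inE; apply/orP; left; apply: imset_f.
    by rewrite /ext insubT ffunE.
  by rewrite pE !phz /psi'; ring.
have dT' : \dim (limg T') = \dim {: K}.
  by apply: limg_dim_eq; rewrite (eqP kerT') capv0.
have := limg_ker_dim T fullv; rewrite capfv -imT' dT'.
have dimK (X : finType) : \dim {: {ffun X -> R^o}} = #|X|.
  by rewrite dimvf /dim /= muln1.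
by rewrite !dimK card_sig card_ord addnC => /esym n_eq; rewrite -cardD; apply/esym.
Qed.

Lemma affdim_gface J : tcyc J -> (0 < #|V|)%N ->
  affdim (gface J) = (size A)%:Z - #|J|%:Z - (ncomp s e J setT)%:Z.
Proof.
move=> tJ V0; have [T TE] := lfun_of_linear (@gface_comb_linear J).
have c0 : (0 < ncomp s e J setT)%N by apply: ncomp_gt0; rewrite -card_gt0 cardsT.
have [l lE] := gale_eval const1_relations.
have l1 x : gface J x -> l x = 1.
  case=> a [_ a1 _ ->]; rewrite linear_sum -a1; apply: eq_bigr => i _.
  by rewrite linearZ /= lE mxE scale_regE mulr1.
suff: affdim (gface J) + 1 = (\dim (limg T))%:Z.
  have := dim_gface_comb tJ V0 TE; lia.
apply/eqP; rewrite eq_le; apply/andP; split.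
  have [X [<- fX XJ]] := affdim_witness (gface J).
  rewrite subrK lez_nat; rewrite (aff_free_free (l := l)) in fX; last by move=> x /XJ /l1.
  rewrite -(eqP fX); apply/dimvS/span_subvP => x /XJ [a [_ _ aJ ->]].
  apply/memv_imgP; exists [ffun i => a i]; first exact: memvf.
  rewrite TE /gface_comb [RHS]big_mkcond /=; apply: eq_bigr => i _; rewrite ffunE.
  by case: ifP => // /negbFE /aJ ->; rewrite scale0r.
have [X sX [fX spX]] := exists_free_span [seq beta i | i <- enum [predC J]].
have XJ x : x \in X -> gface J x.
  move=> /sX /mapP[i]; rewrite mem_enum inE => iJ ->.
  exists (fun j => (j == i)%:R); split=> //.
  - by rewrite (bigD1 i) //= eqxx big1 ?addr0 // => j /negPf ->.
  - by move=> j jJ; rewrite (negPf (contraNneq _ iJ)) // => <-.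
  rewrite (bigD1 i) //= eqxx scale1r big1 ?addr0 // => j /negPf ->.
  by rewrite scale0r.
have fX' : aff_free X by rewrite (aff_free_free (l := l)) // => x /XJ /l1.
rewrite -lerBlDr; apply: le_trans (affdim_ge fX' XJ); rewrite lerD2r lez_nat -(eqP fX) spX.
apply/dimvS/subvP => _ /memv_imgP[y _ ->]; rewrite TE.
apply: memv_suml => i iJ; apply: memvZ; apply: memv_span; apply: map_f.
by rewrite mem_enum.
Qed.

End GaleFaces.

(** * Toric polynomials of the faces *)

Lemma toric_h_sum (R : realType) (W : vectType R) (P : classical_sets.set W)
    (T : finType) (p : pred T) (h : T -> classical_sets.set W) :
  classical_sets.nonempty P ->
  {in p &, injective h} -> (forall F, proper_faces P F <-> exists2 i, p i & F = h i) ->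
  toric_h P = \sum_(i | p i)
    toric_g (h i) * ('X - 1) ^+ `|(affdim P - 1 - affdim (h i))%R|%N.
Proof.
move=> P0 hI hP; rewrite toric_hE //.
have -> : proper_faces P = classical_sets.mkset (fun F => F \in [seq h i | i <- enum p]).
  apply: funext => F; apply: propext; split=> [/hP[i pi ->]|/mapP[i pi ->]].
    by apply: map_f; rewrite mem_enum.
  by apply/hP; exists i; rewrite // -[p i]/(i \in p) -mem_enum.
rewrite -fsbigop.fsbig_seq ?big_map ?big_enum //.
by rewrite map_inj_in_uniq ?enum_uniq // => i j; rewrite !mem_enum; apply: hI.
Qed.

Lemma poly_eq_eval (K : numFieldType) (p q : {poly K}) :
  (forall x : K, x != 0 -> x != 1 -> p.[x] = q.[x]) -> p = q.
Proof.
move=> pq; apply/eqP; rewrite -subr_eq0; apply/eqP.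
apply: (@roots_geq_poly_eq0 _ _ [seq k.+2%:R | k <- iota 0 (size (p - q))]).
- apply/allP => _ /mapP[k _ ->]; rewrite /root hornerD hornerN pq ?subrr //.
    by rewrite pnatr_eq0.
  by rewrite -[1]/1%:R eqr_nat.
- by rewrite map_inj_uniq ?iota_uniq // => i j /eqP; rewrite eqr_nat => /eqP[].
by rewrite size_map size_iota.
Qed.

(** Since deg g <= D/2, the term x^(D+1) g(1/x) has no coefficient in degrees up to D/2; there (1 -
    x) h agrees with g, and its coefficients are the differences in [g_trunc]. *)
Lemma g_trunc_uniq (K : numFieldType) (D : nat) (h : {poly int}) (g : {poly K}) :
  (size g <= D./2.+1)%N ->
  (forall x : K, x != 0 -> x != 1 ->
    (x - 1) * (map_poly intr h).[x] = x ^+ D.+1 * g.[x^-1] - g.[x]) ->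
  map_poly intr (g_trunc D h) = g.
Proof.
move=> sg E; set p := map_poly intr h in E.
have sgD : (size g <= D.+2)%N by apply: leq_trans sg _; lia.
have PE : ('X - 1) * p = \poly_(i < D.+2) g`_(D.+1 - i) - g.
  apply: poly_eq_eval => x x0 x1; rewrite hornerM !hornerD !hornerN hornerX hornerC E //.
  by rewrite horner_rev.
apply/polyP => i; rewrite coef_map /g_trunc coef_poly.
case: ltnP => [iD|iD]; last by rewrite /= mulr0z nth_default // (leq_trans sg).
have := congr1 (fun q : {poly K} => q`_i) PE.
rewrite coefB coef_poly ifT; last by lia.
rewrite [g`_(_ - _)]nth_default; last by apply: leq_trans sg _; lia.
rewrite mulrBl mul1r coefB coefXM sub0r.
case: i iD => [|i] iD /=; rewrite /p !coef_map /= ?sub0r ?rmorphB /=; first by move/oppr_inj.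
by move=> /(congr1 -%R); rewrite opprB opprK.
Qed.

(** Here [a], [b] stand for g at x and 1/x, [la], [lb] for lambda at x and 1/x, and [c.+1] for the
    number of components, so that [n.*2 - j - c.+1] is dim F_J. Eliminating lambda leaves the
    relation required by [g_trunc_uniq]. *)
Lemma kls_identity (K : fieldType) (x v a b la lb h : K) (n j c : nat) :
  x != 0 -> x != 1 -> v != 0 -> (j + c.+1 <= n.*2)%N ->
  v * (x - 1) ^+ c.+1 * h = x ^+ n * (x^-1 ^+ j * la + (-1) ^+ c.+1 * lb) ->
  v * a * (1 - x) ^+ c = x ^+ n * lb ->
  v * b * (1 - x^-1) ^+ c = x^-1 ^+ n * la ->
  (x - 1) * h = x ^+ (n.*2 - j - c.+1).+1 * b - a.
Proof.
move=> x0 x1 v0 jc hE aE bE; have xn m : x ^+ m != 0 by rewrite expf_neq0.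
have y0 : (x - 1) ^+ c != 0 by rewrite expf_neq0 // subr_eq0.
apply: (mulfI (mulf_neq0 v0 y0)); rewrite [LHS](_ : _ = v * (x - 1) ^+ c.+1 * h); last first.
  by rewrite exprS; ring.
rewrite hE mulrDr mulrBr; congr (_ + _).
  have -> : la = x ^+ n * (v * b * (1 - x^-1) ^+ c).
    by rewrite bE mulrA -exprMn divff // expr1n mul1r.
  apply: (mulfI (mulf_neq0 (xn j) (xn c))).
  transitivity ((x ^+ j * x^-1 ^+ j) * (x ^+ n * x ^+ n) * (v * b) *
      (x ^+ c * (1 - x^-1) ^+ c)); first by ring.
  have -> : x ^+ c * (1 - x^-1) ^+ c = (x - 1) ^+ c.
    by rewrite -exprMn mulrBr mulr1 divff.
  have -> : x ^+ j * x^-1 ^+ j = 1 by rewrite -exprMn divff // expr1n.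
  have -> : x ^+ n * x ^+ n = x ^+ j * x ^+ c * x ^+ (n.*2 - j - c.+1).+1.
    by rewrite -!exprD; congr (_ ^+ _); lia.
  by move: (_.+1) => m; ring.
rewrite mulrCA -aE exprS mulN1r mulNr; congr (- _).
have -> : (x - 1) ^+ c = (-1) ^+ c * (1 - x) ^+ c by rewrite -exprMn mulN1r opprB.
by ring.
Qed.

Section ToricGale.
Context {K : numFieldType} {R : realType} {V : finType} (A : seq {ffun V -> R^o}).
Local Notation I := 'I_(size A).
Context (s e : I -> V) (N : {set V} -> nat).
Hypothesis arcE : forall i : I, A`_i = root_vec R (s i) (e i).
Hypothesis conn : forall u v, connect (arc_rel s e [set: I]) u v.
Hypothesis card_arcs_in : forall B, #|arcs_in s e B| = (N B).*2.
Hypothesis balanced : forall B C : {set V},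
  #|[set i | (s i \in B) && (e i \in C)]| = #|[set i | (s i \in C) && (e i \in B)]|.
Hypothesis V_gt0 : (0 < #|V|)%N.

Implicit Types (J : {set I}).
Local Notation tcyc := (tcyc s e).
Local Notation ncomp J := (ncomp s e J [set: V]).
Local Notation n := (N [set: V]).
Local Notation lambda J x := (dlog (wt s e N J x) [set: V]).

Let bal1 v : #|[set i | s i == v]| = #|[set i | e i == v]|.
Proof.
transitivity #|[set i | (s i \in [set v]) && (e i \in [set: V])]|.
  by apply: eq_card => i; rewrite !inE andbT.
by rewrite balanced; apply: eq_card => i; rewrite !inE.
Qed.

Let sizeA : size A = n.*2.
Proof. by rewrite -card_arcs_in arcs_inT cardsT card_ord. Qed.

Let ncomp_pos J : (0 < ncomp J)%N.
Proof. by apply: ncomp_gt0; rewrite -card_gt0 cardsT. Qed.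

Let affdimE J : tcyc J -> affdim (gface J) = n.*2%:Z - #|J|%:Z - (ncomp J)%:Z.
Proof. by move=> tJ; rewrite (affdim_gface arcE bal1 conn tJ V_gt0); congr (_%:Z - _ - _); apply: sizeA. Qed.

Let gface_neq0 J : J != [set: I] -> classical_sets.nonempty (gface J).
Proof.
move=> JT; have /subsetPn[i _ iJ] : ~~ ([set: I] \subset J) by rewrite subTset.
exists (@gale_vec R _ A i), (fun j => (j == i)%:R); split=> //.
- by rewrite (bigD1 i) //= eqxx big1 ?addr0 // => j /negPf ->.
- by move=> j jJ; rewrite (negPf (contraNneq _ iJ)) // => <-.
by rewrite (bigD1 i) //= eqxx scale1r big1 ?addr0 // => j /negPf ->; rewrite scale0r.
Qed.

Definition g_formula J := forall x : K, x != 0 ->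
  #|V|%:R * (map_poly intr (toric_g (gface J))).[x] * (1 - x) ^+ (ncomp J).-1 =
  x ^+ n * lambda J x^-1.

(** This is [kernel_identity] with the term [G = J] moved across; the remaining [G] are the proper
    faces. *)
Lemma gface_h J : tcyc J -> J != [set: I] ->
  (forall J', tcyc J' -> J \proper J' -> g_formula J') ->
  forall x : K, x != 0 ->
  #|V|%:R * (x - 1) ^+ ncomp J * (map_poly intr (toric_h (gface J))).[x] =
  x ^+ n * (x^-1 ^+ #|J| * lambda J x + (-1) ^+ ncomp J * lambda J x^-1).
Proof.
move=> tJ JT IH x x0.
have faces F : proper_faces (gface J) F <->
    exists2 J', tcyc J' && (J \proper J') & F = gface J'.
  split=> [[/(gfaceP arcE bal1 F tJ)[J' [tJ' sJ ->]] nJ]|[J' /andP[tJ' sJ] ->]].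
    exists J' => //; rewrite tJ' properEneq sJ andbT /=.
    by apply/eqP => JJ; apply: nJ; rewrite JJ.
  split; first by apply/(gfaceP arcE bal1 _ tJ); exists J'; split=> //; exact: proper_sub.
  by move=> /(gface_inj arcE tJ' tJ) JJ; rewrite JJ properxx in sJ.
rewrite (toric_h_sum (gface_neq0 JT) _ faces); last first.
  by move=> J1 J2 /andP[t1 _] /andP[t2 _]; apply: (gface_inj arcE).
rewrite rmorph_sum horner_sum big_distrr /=.
have -> : ncomp J = (ncomp J).-1.+1 by rewrite (prednK (ncomp_pos J)).
have kerI := kernel_identity card_arcs_in balanced x0 tJ.
rewrite (bigD1 J) ?subxx ?tJ //= in kerI.
rewrite setDv cards0 expr0 mulr1 in kerI.
transitivity (- x ^+ n * \sum_(G : {set I} | (J \subset G) && tcyc G && (G != J))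
   (-1) ^+ ncomp G * (x - 1) ^+ #|G :\: J| * lambda G x^-1); last first.
  set S := \sum_(G | _) _ in kerI *.
  have -> : S = - (x^-1 ^+ #|J| * lambda J x) - (-1) ^+ ncomp J * lambda J x^-1.
    by rewrite -kerI addrAC subrr add0r.
  rewrite (prednK (ncomp_pos J)).
  by rewrite mulNr -mulrN opprD !opprK.
rewrite big_distrr /=; apply: eq_big => [G|G /andP[tG JG]].
  rewrite properEneq [J == G]eq_sym.
  by case: (tcyc G); case: (J \subset G); case: (G == J).
have := affdim_proper_face (P := gface J) (F := gface G).
rewrite !affdimE // => /(_ _) lt_dim.
have {}lt_dim := lt_dim ((faces _).2 (ex_intro2 _ _ G (introT andP (conj tG JG)) erefl)).
have cGJ : #|G| = (#|J| + #|G :\: J|)%N.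
  by rewrite cardsD (setIidPr (proper_sub JG)) subnKC // subset_leq_card // proper_sub.
have pJ := ncomp_pos J; have pG := ncomp_pos G.
(* [k] is dim F_J - 1 - dim F_G. The surplus (x - 1)^(c(G) - 1) is, up to sign, the power of 1 - x
   in [g_formula G]. *)
set k := absz _; have kE : (k + ncomp J = #|G :\: J| + (ncomp G).-1)%N.
  rewrite /k; move: lt_dim pG; rewrite cGJ.
  by move: #|J| #|_ :\: _| (ncomp G) (ncomp J) n => a b c d f; lia.
clearbody k; rewrite rmorphM rmorphXn rmorphB /= map_polyX rmorph1.
rewrite hornerM horner_exp hornerD hornerN hornerX hornerC (prednK (ncomp_pos J)).
transitivity ((x - 1) ^+ (k + ncomp J) * (#|V|%:R * (map_poly intr (toric_g (gface G))).[x])).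
  by rewrite exprD; move: (map_poly _ _).[x] (ncomp J) => a c; ring.
have sg m : (x - 1) ^+ m = (-1) ^+ m * (1 - x) ^+ m by rewrite -exprMn mulN1r opprB.
rewrite kE exprD (sg (ncomp G).-1).
have := IH G tG JG x x0; move: (map_poly _ _).[x] => S gG.
transitivity ((x - 1) ^+ #|G :\: J| * (-1) ^+ (ncomp G).-1 *
   (#|V|%:R * S * (1 - x) ^+ (ncomp G).-1)).
  by move: (ncomp G).-1 #|_ :\: _| #|V| => a b c; ring.
rewrite gG -{2}(prednK pG) exprS; move: (lambda G x^-1) (ncomp G).-1 #|_ :\: _| n => a b c d; ring.
Qed.

Lemma gface_g J : tcyc J -> g_formula J.
Proof.
have [k] := ubnP #|~: J|; elim: k J => // k IH J; rewrite ltnS => Jk tJ x x0.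
(* The set of all arcs gives the empty face, where g = 1; the digraph is connected, so
   [dlog_wt_connected] applies. *)
have [JT|JT] := eqVneq J [set: I].
  have c1 : ncomp J = 1%N.
    rewrite JT; apply: ncomp1; [by rewrite -card_gt0 cardsT|exact: jclosedT|].
    by move=> u v _ _; apply: conn.
  rewrite dlog_wt_connected // c1 expr0 mulr1 mulrCA -exprMn divff // expr1n.
  rewrite (_ : gface J = classical_sets.set0) ?toric_g0 ?rmorph1 ?hornerC //.
  apply: funext => y; apply: propext; split=> // -[a [_ a1 aJ _]].
  by move: a1; rewrite big1 => [/esym/eqP|i _]; rewrite ?oner_eq0 // aJ // JT inE.
have {}IH J' : tcyc J' -> J \proper J' -> g_formula J'.
  move=> tJ' JJ'; apply: IH => //; apply: leq_trans Jk; apply: proper_card.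
  by rewrite properC.
have hJ := gface_h tJ JT IH.
have [g sg gE] := gale_g_poly (K := K) card_arcs_in balanced tJ V_gt0.
have [y0 Py0] := gface_neq0 JT.
rewrite toric_gE; last by exists y0.
have pJ := ncomp_pos J.
have dimE := affdimE tJ; have dim0 : 0 <= affdim (gface J).
  by apply: affdim_ge0; exists y0.
have DE : `|affdim (gface J)|%N = (n.*2 - #|J| - ncomp J)%N by lia.
have D2 : (#|J| + ncomp J <= n.*2)%N by lia.
rewrite DE (@g_trunc_uniq _ _ _ g) ?gE // => {x x0} x x0 x1.
have xV0 : x^-1 != 0 by rewrite invr_eq0.
have := gE _ xV0; rewrite invrK => gEV.
have nV : (#|V|%:R : K) != 0 by rewrite pnatr_eq0 -lt0n.
have := hJ x x0; rewrite -(prednK pJ) in D2 *.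
by move=> hx; apply: (kls_identity x0 x1 nV D2 hx (gE x x0) gEV).
Qed.

Lemma toric_h_gale : [set: I] != finset.set0 -> forall x : K, x != 0 ->
  #|V|%:R * (1 - x) ^+ #|V| * (map_poly intr (toric_h (gale_polytope A))).[x] =
  x ^+ n * (lambda finset.set0 x^-1 + (-1) ^+ #|V| * lambda finset.set0 x).
Proof.
move=> I0 x x0; have t0 : tcyc finset.set0 by apply/tcycP => i; rewrite inE.
have c0 : ncomp finset.set0 = #|V|.
  by rewrite ncomp_arcless cardsT.
have := gface_h t0 _ (fun J tJ _ => gface_g tJ) x0; rewrite eq_sym I0 => /(_ isT).
rewrite c0 cards0 expr0 mul1r -gface0 => hE.
move: (map_poly _ _).[x] (lambda _ x) (lambda _ x^-1) hE => h a b hE.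
have -> : (1 - x) ^+ #|V| = (-1) ^+ #|V| * (x - 1) ^+ #|V|.
  by rewrite -exprMn mulN1r opprB.
rewrite mulrCA -!mulrA in hE *; rewrite mulrA in hE.
have sgn2 : (-1) ^+ #|V| * (-1) ^+ #|V| = 1 :> K by rewrite -expr2 sqrr_sign.
transitivity ((-1) ^+ #|V| * (x ^+ n * (a + (-1) ^+ #|V| * b))); first by rewrite -hE; ring.
by rewrite mulrCA mulrDr mulrA sgn2 mul1r addrC.
Qed.

End ToricGale.

(** * Root polytopes and set partitions *)

Lemma sum_sym_double (T : finType) (P : pred T) (rho : T -> nat) (d : T -> T -> nat) :
  injective rho -> (forall i j, d i j = d j i) ->
  (\sum_(i | P i) \sum_(j | P j) d i j =
   \sum_(i | P i) d i i + (\sum_(i | P i) \sum_(j | P j && (rho i < rho j)) d i j).*2)%N.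
Proof.
move=> rhoI dC; rewrite -addnn addnA -[in RHS]big_split /=.
rewrite [X in (_ + X)%N](exchange_big_dep P) /=; last by move=> i j _ /andP[].
rewrite -big_split; apply: eq_bigr => i Pi /=.
rewrite (bigD1 i) //= -addnA; congr addn.
rewrite (bigID (fun j => rho i < rho j)%N) /=; congr addn.
  by apply: eq_bigl => j; case: (eqVneq j i) => [->|]; rewrite ?ltnn ?andbF ?andbT.
apply: eq_big => [j|j _]; last exact: dC.
by rewrite Pi /= -leqNgt [(rho j < rho i)%N]ltn_neqAle (inj_eq rhoI) -andbA.
Qed.

(** Subsets of [f @: A] correspond to subsets of [A], and [dlog_uniq] does the rest. It moves the
    polytope of a part, built on a subtype, back to subsets of [V]. *)
Lemma dlog_transfer (T V : finType) (K : comNzRingType) (f : T -> V)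
    (F' : setfun T K) (F : setfun V K) (A : {set T}) :
  injective f -> (forall B, F' B = F (f @: B)) -> F set0 = 1 ->
  dlog F' A = dlog F (f @: A).
Proof.
move=> fI F'E F0; pose G : setfun T K := [ffun B : {set T} => dlog F (f @: B)].
have F'0 : F' set0 = 1 by rewrite F'E imset0.
suff /(dlog_uniq F'0) <- : euler F' = G * F' by rewrite [LHS]ffunE.
apply/ffunP => B; rewrite eulerE F'E -(card_imset _ fI) -eulerE euler_dlog // !sf_mulE.
rewrite (reindex_onto (fun C : {set T} => f @: C) (fun C => f @^-1: C)) /=; last first.
  move=> C /subsetP sC; apply/setP => v; apply/imsetP/idP => [[t]|vC].
    by rewrite inE => tC ->.
  by have /imsetP[t _ vE] := sC v vC; exists t; rewrite // inE -vE.
apply: eq_big => [C|C _].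
  have -> : f @^-1: [set f t | t in C] = C by apply/setP => t; rewrite inE mem_imset.
  rewrite eqxx andbT; apply/idP/idP => [/subsetP sC|sC]; last exact: imsetS.
  by apply/subsetP => t tC; have := sC (f t); rewrite !mem_imset //; apply.
have -> : G C = dlog F (f @: C) by rewrite [LHS]ffunE.
rewrite F'E; congr (_ * F _); apply/setP => v.
apply/setDP/imsetP => [[/imsetP[t tB ->]]|[t /setDP[tB tC] ->]].
  by rewrite mem_imset // => tC; exists t; rewrite // inE tC.
by rewrite !mem_imset.
Qed.

(** Multiply by |A|, the sum of the block sizes of a partition: this marks a block B with weight
    |B|, and deleting B leaves a partition of A \ B. That is the convolution
    [euler F = dlog F * F]. *)
Lemma exponential_formula (V : finType) (K : numFieldType) (F : setfun V K) (f : {set V} -> K) :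
  F set0 = 1 -> (forall A : {set V}, #|A|%:R * f A = dlog F A) ->
  forall A : {set V}, F A = \sum_(Q | finset.partition Q A) \prod_(B in Q) f B.
Proof.
move=> F0 fE A; have [k] := ubnP #|A|; elim: k A => // k IH A; rewrite ltnS => Ak.
have [->|A0] := eqVneq A set0.
  rewrite F0 (big_pred1 finset.set0) => [|Q]; last by rewrite partition_set0.
  by rewrite big_set0.
have nA : (#|A|%:R : K) != 0 by rewrite pnatr_eq0 cards_eq0.
apply: (mulfI nA); rewrite -eulerE euler_dlog // sf_mulE big_distrr /=.
transitivity (\sum_(Q | finset.partition Q A) \sum_(B in Q)
    #|B|%:R * \prod_(C in Q) f C); last first.
  apply: eq_bigr => Q QA; rewrite -big_distrl /= (card_partition QA) natr_sum.
  by [].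
rewrite (exchange_big_dep (fun B : {set V} => (B \subset A) && (B != set0))) /=; last first.
  by move=> Q B QA BQ; rewrite (partitionS QA BQ) (partition_neq0 QA BQ).
rewrite (bigID (fun B => B != set0)) /= [X in _ + X]big1 ?addr0; last first.
  by move=> B /andP[_ /negPn/eqP ->]; rewrite -fE cards0 !mul0r.
apply: eq_bigr => B /andP[sBA B0]; rewrite -fE IH; last first.
  apply: leq_trans Ak; apply: proper_card; rewrite properE subsetDl.
  case/set0Pn: B0 => b bB; apply/subsetPn.
  by exists b; [exact: (subsetP sBA)|rewrite inE bB].
rewrite -mulrA big_distrr big_distrr /=.
have nB Q : finset.partition Q (A :\: B) -> B \notin Q.
  move=> QA; apply: contra B0 => BQ; have := partitionS QA BQ.
  by rewrite subsetD => /andP[_]; rewrite -setI_eq0 setIid.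
rewrite [RHS](reindex_onto (fun Q => B |: Q) (fun Q => Q :\ B)) /=; last first.
  by move=> Q /andP[_ /setD1K].
apply: eq_big => [Q|Q QA]; last by rewrite big_setU1 ?nB.
apply/idP/andP => [QA|[/andP[QA _] /eqP QB]].
  rewrite setU1K ?nB // eqxx setU11 andbT; split=> //.
  rewrite -(subset_setUD sBA); apply: partitionU1 => //.
  by rewrite -setI_eq0 setIDA setIC -setIDA setDv setI0.
by rewrite -QB; apply: partitionD1 => //; apply: setU11.
Qed.

(** * The digraph of the root configuration *)

Section RootArcs.
Context {V : finType} (r : V -> V -> nat).
Hypothesis r_sym : forall i j, r i j = r j i.
Hypothesis r_gt0 : forall i j, i != j -> (0 < r i j)%N.
Implicit Types A B C : {set V}.

(** Roots join distinct vertices, so the diagonal is set to zero. *)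
Definition arc_mult i j := if i == j then 0%N else r i j.
Definition cross_mult A B := (\sum_(i in A) \sum_(j in B) arc_mult i j)%N.
Definition half_mult A := (cross_mult A A)./2.

Lemma arc_multC i j : arc_mult i j = arc_mult j i.
Proof. by rewrite /arc_mult eq_sym r_sym. Qed.

Lemma cross_multC A B : cross_mult A B = cross_mult B A.
Proof.
rewrite /cross_mult exchange_big; apply: eq_bigr => i _; apply: eq_bigr => j _.
exact: arc_multC.
Qed.

Lemma cross_multUl A B C : [disjoint A & B] ->
  cross_mult (A :|: B) C = (cross_mult A C + cross_mult B C)%N.
Proof.
move=> dAB; rewrite /cross_mult (eq_bigl [predU A & B]) ?bigU // => i.
by rewrite !inE.
Qed.

Lemma half_mult_double A : (half_mult A).*2 = cross_mult A A.
Proof.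
rewrite /half_mult even_halfK //.
rewrite /cross_mult (sum_sym_double (fun i => i \in A)
  (fun i j (H : enum_rank i = enum_rank j :> nat) => enum_rank_inj (val_inj H))); last exact: arc_multC.
by rewrite big1 ?add0n ?odd_double // => i _; rewrite /arc_mult eqxx.
Qed.

Lemma half_multU A B : [disjoint A & B] ->
  half_mult (A :|: B) = (half_mult A + half_mult B + cross_mult A B)%N.
Proof.
move=> dAB; apply: double_inj; rewrite !doubleD !half_mult_double cross_multUl //.
rewrite ![cross_mult _ (A :|: B)]cross_multC !cross_multUl // (cross_multC B A); lia.
Qed.

Lemma half_mult0 : half_mult set0 = 0%N.
Proof. by rewrite /half_mult /cross_mult big_set0. Qed.

Lemma half_mult1 v : half_mult [set v] = 0%N.
Proof. by rewrite /half_mult /cross_mult !big_set1 /arc_mult eqxx. Qed.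

(** Lists endpoints in the order of [root_seq], so that the arc of a given index is read off by
    position. *)
Definition root_ends : seq (V * V) :=
  flatten [seq nseq (r p.1 p.2) p | p <- enum {: V * V} & p.1 != p.2].

Lemma count_root_ends (P : pred (V * V)) :
  count P root_ends = (\sum_(p : V * V | P p) arc_mult p.1 p.2)%N.
Proof.
rewrite count_flatten sumnE !big_map big_filter big_enum_cond /=.
rewrite [RHS]big_mkcond [LHS]big_mkcond; apply: eq_bigr => p _ /=.
by rewrite count_nseq /arc_mult; case: eqP; case: (P p); rewrite ?mul1n ?mul0n.
Qed.

Context (R : realType).

Lemma root_seqE : root_seq R r = [seq root_vec R p.1 p.2 | p <- root_ends].
Proof.
rewrite /root_seq map_flatten -map_comp; congr flatten; apply: eq_map => p /=.
by rewrite map_nseq.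
Qed.

Lemma size_root_ends : size (root_seq R r) = size root_ends.
Proof. by rewrite root_seqE size_map. Qed.

Definition arc_ends (i : 'I_(size (root_seq R r))) : V * V :=
  tnth (in_tuple root_ends) (cast_ord size_root_ends i).
Definition arc_src i := (arc_ends i).1.
Definition arc_tgt i := (arc_ends i).2.

Lemma root_seq_arc (i : 'I_(size (root_seq R r))) :
  (root_seq R r)`_i = root_vec R (arc_src i) (arc_tgt i).
Proof.
have /(congr1 (fun t => nth 0 t i)) -> := root_seqE.
rewrite (nth_map (arc_ends i)) -?size_root_ends //.
by rewrite /arc_src /arc_tgt {3 4}/arc_ends !(tnth_nth (arc_ends i)).
Qed.

Lemma card_arc_ends (P : pred (V * V)) :
  #|[set i | P (arc_ends i)]| = (\sum_(p : V * V | P p) arc_mult p.1 p.2)%N.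
Proof.
rewrite -count_root_ends -sum1_count big_tnth -sum1_card.
rewrite (reindex (cast_ord size_root_ends)) /=; last first.
  by exists (cast_ord (esym size_root_ends)) => i _; rewrite ?cast_ordK ?cast_ordKV.
by apply: eq_bigl => i; rewrite inE.
Qed.

Lemma card_arcs A B :
  #|[set i | (arc_src i \in A) && (arc_tgt i \in B)]| = cross_mult A B.
Proof.
rewrite (card_arc_ends (fun p => (p.1 \in A) && (p.2 \in B))) /cross_mult.
by rewrite pair_big.
Qed.

Lemma card_arcs_in_root A : #|arcs_in arc_src arc_tgt A| = (half_mult A).*2.
Proof. by rewrite card_arcs half_mult_double. Qed.

Lemma arc_exists u v : u != v -> exists i, arc_ends i = (u, v).
Proof.
move=> uv; have : (0 < #|[set i | arc_ends i == (u, v)]|)%N.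
  rewrite (card_arc_ends (pred1 (u, v))) big_pred1_eq /arc_mult (negPf uv).
  exact: r_gt0.
by case/card_gt0P => i; rewrite inE => /eqP ?; exists i.
Qed.

Lemma root_arcs_connected u v : connect (arc_rel arc_src arc_tgt [set: _]) u v.
Proof.
have [->|/arc_exists[i iE]] := eqVneq u v; first exact: connect0.
by apply/connect1/arc_relP; exists i; rewrite /arc_src /arc_tgt iE inE.
Qed.

Definition pow_half {K : pzSemiRingType} (x : K) : setfun V K :=
  [ffun A : {set V} => x ^+ half_mult A].

Lemma pow_half0 (K : pzSemiRingType) (x : K) : pow_half x set0 = 1.
Proof. by rewrite ffunE half_mult0. Qed.

Lemma wt_pow_half (K : pzSemiRingType) (x : K) :
  wt arc_src arc_tgt half_mult finset.set0 x = pow_half x.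
Proof.
apply/ffunP => A; rewrite !ffunE (_ : jclosed _ _ _ _) ?mul1r //.
by apply/jclosedP => i; rewrite inE.
Qed.

Lemma toric_h_root (K : numFieldType) (x : K) : (2 <= #|V|)%N -> x != 0 ->
  #|V|%:R * (1 - x) ^+ #|V| * (map_poly intr (toric_h (gale_root_polytope R r))).[x] =
  x ^+ half_mult setT *
    (dlog (pow_half x^-1) setT + (-1) ^+ #|V| * dlog (pow_half x) setT).
Proof.
move=> V2 x0; rewrite -!wt_pow_half.
apply: (toric_h_gale root_seq_arc root_arcs_connected card_arcs_in_root) => //.
- by move=> A B; rewrite !card_arcs cross_multC.
- exact: leq_trans V2.
have [u [v uv]] : exists u v : V, u != v.
  by have /card_gt1P[u [v [_ _ uv]]] := V2; exists u, v.
by have [i _] := arc_exists uv; apply/eqP => /setP/(_ i); rewrite !inE.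
Qed.

End RootArcs.

Lemma sub_toric_h_root (R : realType) (K : numFieldType) (V : finType) (r : V -> V -> nat)
    (S : {set V}) (x : K) :
  (forall i j, r i j = r j i) -> (forall i j, i != j -> (0 < r i j)%N) ->
  (2 <= #|S|)%N -> x != 0 ->
  #|S|%:R * (1 - x) ^+ #|S| * (map_poly intr (toric_h (sub_gale_root_polytope R r S))).[x] =
  x ^+ half_mult r S *
    (dlog (pow_half r x^-1) S + (-1) ^+ #|S| * dlog (pow_half r x) S).
Proof.
move=> r_sym r_gt0 S2 x0; pose T := {v | v \in S}; pose r' (i j : T) := r (val i) (val j).
have cT : #|{: T}| = #|S| by rewrite card_sig.
have vT : val @: [set: T] = S.
  apply/setP => v; apply/imsetP/idP => [[u _ ->]|vS]; first exact: valP.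
  by exists (Sub v vS); rewrite ?SubK.
have hE (A : {set T}) : half_mult r' A = half_mult r (val @: A).
  rewrite /half_mult /cross_mult big_imset => [|? ? _ _]; last exact: val_inj.
  congr (_./2); apply: eq_bigr => i _; rewrite big_imset => [|? ? _ _]; last exact: val_inj.
  by apply: eq_bigr => j _; rewrite /arc_mult (inj_eq val_inj).
have dE (y : K) : dlog (pow_half r' y) [set: T] = dlog (pow_half r y) S.
  rewrite (dlog_transfer (f := val) (F := pow_half r y)) ?vT ?pow_half0 //; first exact: val_inj.
  by move=> A; rewrite !ffunE hE.
have := @toric_h_root T r' _ _ R K x _ x0; rewrite cT hE vT !dE; apply=> //.
- by move=> i j; apply: r_sym.
by move=> i j ij; apply: r_gt0; rewrite (inj_eq val_inj).
Qed.

(** * The product formula and the sum over set partitions *)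

Section Assembly.
Context {V : finType} (r : V -> V -> nat).
Hypothesis r_sym : forall i j, r i j = r j i.

(** Summing the degrees r_i over the complement of [B] counts its inner pairs twice and the pairs
    crossing to [B] once. *)
Lemma half_mult_setT (B : {set V}) :
  (half_mult r setT + half_mult r (~: B) =
   half_mult r B + \sum_(i in ~: B) \sum_(j | j != i) r i j)%N.
Proof.
have dB : [disjoint B & ~: B] by rewrite disjoints_subset setCK.
rewrite -(setUCr B) half_multU // [RHS](_ : _ = half_mult r B + cross_mult r (~: B) setT)%N.
  rewrite -(setUCr B) (cross_multC r_sym (~: B)) cross_multUl // -(half_mult_double r_sym (~: B)).
  by rewrite -addnn; lia.
congr addn; apply: eq_bigr => i _; rewrite [LHS]big_mkcond; apply: eq_big => [j|j _].
  by rewrite inE.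
by rewrite /arc_mult eq_sym; case: eqP.
Qed.

(** Over ordered pairs of blocks, the diagonal pairs give 2 N(S) and every cross term appears
    twice. *)
Lemma half_mult_partition (Q : {set {set V}}) : finset.partition Q [set: V] ->
  half_mult r setT = (\sum_(S in Q) half_mult r S + cross_weight r Q)%N.
Proof.
move=> QT; apply: double_inj; rewrite doubleD half_mult_double //.
rewrite /cross_mult (set_partition_big _ QT) /=.
transitivity (\sum_(S in Q) \sum_(S' in Q) cross_mult r S S')%N.
  apply: eq_bigr => S _; rewrite [RHS]exchange_big /=; apply: eq_bigr => i _.
  by rewrite (set_partition_big _ QT).
rewrite big_enum_val /=; under eq_bigr do rewrite big_enum_val /=.
rewrite (@sum_sym_double _ xpredT (@nat_of_ord _)); last 2 first.
- exact: val_inj.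
- by move=> m n; apply: cross_multC.
congr addn.
  rewrite [in RHS]big_enum_val -mul2n big_distrr /=; apply: eq_bigr => m _.
  by rewrite mul2n half_mult_double.
congr (_.*2); apply: eq_bigr => m _; apply: eq_bigr => n /= mn.
apply: eq_bigr => i im; apply: eq_bigr => j jn; rewrite /arc_mult.
case: eqP => // ij; have /trivIsetP/(_ _ _ (enum_valP m) (enum_valP n)) := partition_trivIset QT.
rewrite (inj_eq enum_val_inj) neq_ltn mn /= => /(_ isT)/pred0P/(_ i) /=.
by rewrite im ij jn.
Qed.

Context {K : numFieldType} (x : K).
Hypothesis x_neq0 : x != 0.

Definition signed_pow : setfun V K := sf_scale (fun A : {set V} => (-1) ^+ #|A|) (pow_half r x).

Lemma dlog_pow_half_mul (A : {set V}) :
  dlog (pow_half r x^-1 * signed_pow) A =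
  dlog (pow_half r x^-1) A + (-1) ^+ #|A| * dlog (pow_half r x) A.
Proof.
have c0 : (-1) ^+ #|@set0 V| = 1 :> K by rewrite cards0.
rewrite dlogM ?pow_half0 //; last by rewrite ffunE c0 pow_half0 mulr1.
rewrite sf_addE dlog_scale ?pow_half0 // => [|B C dBC]; first by rewrite [X in _ + X]ffunE.
by rewrite -exprD cardsU disjoint_setI0 // cards0 subn0.
Qed.

Lemma dlog_pow_half1 (y : K) (v : V) : dlog (pow_half r y) [set v] = 1.
Proof.
rewrite /dlog sf_mulE (bigD1 [set v]) //= setDv sf_inv0 mulr1 eulerE cards1 mul1r.
rewrite ffunE half_mult1 big1 ?addr0 // => B /andP[].
by rewrite subset1 => /orP[->//|/eqP ->]; rewrite eulerE cards0 !mul0r.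
Qed.

(** By [half_mult_setT] the term of [B] in the convolution is the product of - x^(r_i) over i
    outside [B]. *)
Lemma pow_half_mul_setT :
  x ^+ half_mult r setT * (pow_half r x^-1 * signed_pow) setT =
  \prod_i (1 - x ^+ \sum_(j | j != i) r i j).
Proof.
rewrite sf_mulE bigA_distr big_distrr /=.
apply: eq_big => [B|B _]; first by rewrite subsetT.
rewrite setTD !ffunE (bigID (fun i => i \in B)) /= big1 ?mul1r => [|i ->] //.
transitivity (\prod_(i in ~: B) - x ^+ (\sum_(j | j != i) r i j)); last first.
  by apply: eq_big => [i|i]; rewrite inE // => /negPf ->.
rewrite prodrN prodrXr; set m := (\sum_(i in _) _)%N.
have E : x ^+ half_mult r setT * x ^+ half_mult r (~: B) = x ^+ half_mult r B * x ^+ m.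
  by rewrite -!exprD half_mult_setT.
have swap (a b c d : K) : a * (b * (c * d)) = c * (b * (a * d)) by ring.
rewrite swap; congr (_ * _).
by rewrite E mulrA -exprMn mulVf // expr1n mul1r.
Qed.


Lemma sum_partition_pow :
  \prod_i (1 - x ^+ \sum_(j | j != i) r i j) = x ^+ half_mult r setT *
  \sum_(Q | finset.partition Q [set: V]) \prod_(S in Q)
    (#|S|%:R^-1 * (dlog (pow_half r x^-1) S + (-1) ^+ #|S| * dlog (pow_half r x) S)).
Proof.
rewrite -pow_half_mul_setT; congr (_ * _); apply: exponential_formula => [|A].
  by rewrite sf_mul0 !ffunE cards0 half_mult0 !mulr1.
rewrite dlog_pow_half_mul mulrA; have [->|A0] := eqVneq A set0.
  by rewrite cards0 !mul0r /dlog !sf_mul0 !eulerE cards0 !mul0r mulr0 addr0.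
by rewrite divff ?mul1r // pnatr_eq0 cards_eq0.
Qed.

Lemma partition_cases (Q : {set {set V}}) : (2 <= #|V|)%N ->
  finset.partition Q [set: V] -> Q != [set [set: V]] -> ~~ thick_partition Q ->
  exists v, [set v] \in Q.
Proof.
move=> V2 QT Q1; rewrite /thick_partition QT /= negb_and => thin.
have Q2 : (2 <= #|Q|)%N.
  rewrite ltnNge; apply: contra Q1 => Q1; have coverQ := cover_partition QT.
  have Q0 : Q != set0.
    apply: contraTneq V2 => Q0; move: coverQ; rewrite Q0 /cover big_set0 -cardsT => <-.
    by rewrite cards0.
  have /cards1P[S QS] : #|Q| == 1%N by rewrite eqn_leq Q1 card_gt0.
  by rewrite QS -coverQ QS /cover big_set1.
move: thin; rewrite Q2 /= negb_forall => /existsP[S]; rewrite negb_imply -ltnNge ltnS.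
move=> /andP[SQ S1]; have /cards1P[v Sv] : #|S| == 1%N.
  by rewrite eqn_leq S1 card_gt0 (partition_neq0 QT SQ).
by exists v; rewrite -Sv.
Qed.

End Assembly.

Theorem theorem5p3 (R : realType) (k : nat) (r : 'I_k -> 'I_k -> nat)
    (k_ge2 : (2 <= k)%N)
    (r_gt0 : forall i j : 'I_k, i != j -> (0 < r i j)%N)
    (r_sym : forall i j : 'I_k, r i j = r j i) :
  toric_h (gale_root_polytope R r) =
    \prod_(i < k) (\sum_(l < (\sum_(j < k | j != i) r i j)%N) 'X^l)
    - \sum_(Q : {set {set 'I_k}} | thick_partition Q)
        'X^(cross_weight r Q)
        * \prod_(S in Q) toric_h (sub_gale_root_polytope R r S).
Proof.
(* Over the rationals the identity is tested at points other than 0 and 1, where x and 1 - x can be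
   cancelled. *)
apply: (@map_inj_poly _ _ (intr : int -> rat)) => //; first exact: intr_inj.
apply: poly_eq_eval => x x0 x1.
have V2 : (2 <= #|'I_k|)%N by rewrite card_ord.
have y0 m : (1 - x) ^+ m != 0 by rewrite expf_neq0 // subr_eq0 eq_sym.
pose f (S : {set 'I_k}) : rat := #|S|%:R^-1 *
  (dlog (pow_half r x^-1) S + (-1) ^+ #|S| * dlog (pow_half r x) S).
pose h (S : {set 'I_k}) : rat :=
  (map_poly intr (toric_h (sub_gale_root_polytope R r S))).[x].
set hT := (map_poly intr (toric_h (gale_root_polytope R r))).[x].
have nS (S : {set 'I_k}) : (2 <= #|S|)%N -> (#|S|%:R : rat) != 0.
  by move=> S2; rewrite pnatr_eq0 -lt0n; apply: leq_trans S2.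
have fT : x ^+ half_mult r setT * f setT = (1 - x) ^+ k * hT.
  rewrite /f mulrCA cardsT -(toric_h_root r_sym r_gt0 R V2 x0) card_ord.
  by rewrite -mulrA mulKf // pnatr_eq0 -lt0n; apply: leq_trans k_ge2.
have fS (S : {set 'I_k}) : (2 <= #|S|)%N -> x ^+ half_mult r S * f S = (1 - x) ^+ #|S| * h S.
  move=> S2; rewrite /f mulrCA -(sub_toric_h_root R r_sym r_gt0 S2 x0) -mulrA mulKf //.
  exact: nS.
(* At a singleton [dlog] is 1 at both x and 1/x, and the sign (-1)^1 cancels them: partitions with a
   one-point part drop out. *)
have f1 v : f [set v] = 0.
  by rewrite /f !dlog_pow_half1 cards1 expr1 mulr1 subrr mulr0.
rewrite rmorphB rmorph_prod rmorph_sum hornerD hornerN horner_prod horner_sum /=.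
apply/eqP; rewrite eq_sym subr_eq; apply/eqP/(mulfI (y0 k)).
rewrite mulrDr.
have -> : (1 - x) ^+ k * \prod_(i < k)
    (map_poly intr (\sum_(l < \sum_(j < k | j != i) r i j) 'X^l)).[x] =
    \prod_i (1 - x ^+ \sum_(j | j != i) r i j).
  rewrite -[k in _ ^+ k]card_ord -prodr_const -big_split; apply: eq_bigr => i _ /=.
  rewrite rmorph_sum horner_sum -[RHS]opprB subrX1 -mulNr opprB; congr (_ * _).
  by apply: eq_bigr => l _ /=; rewrite map_polyXn hornerXn.
rewrite (sum_partition_pow r_sym x0) -/f (bigD1 [set [set: 'I_k]]) /=; last first.
  apply/and3P; split; [by rewrite cover1|exact: trivIset1|].
  by rewrite inE eq_sym -card_gt0 cardsT card_ord (leq_trans _ k_ge2).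
(* The one-block partition accounts for the polytope itself. *)
rewrite big_set1 mulrDr fT; congr (_ + _).
rewrite (bigID (@thick_partition _)) /= [X in _ + X]big1 ?addr0; last first.
  move=> Q /andP[/andP[QT Q1] /(partition_cases V2 QT Q1)[v vQ]].
  by rewrite (bigD1 [set v]) //= -/(f _) f1 mul0r.
rewrite !big_distrr /=; apply: eq_big => [Q|Q /andP[/andP[QT _] thQ]].
  rewrite andbC; case: (boolP (thick_partition Q)) => //= /and3P[-> Q2 _] /=.
  by apply: contraTneq Q2 => ->; rewrite cards1.
rewrite rmorphM rmorph_prod /= map_polyXn hornerM hornerXn horner_prod.
(* The power x^N(V) splits into the x^N(S) needed by [fS] and the cross weight; the factors (1 -
   x)^|S| multiply to (1 - x)^k. *)
rewrite (half_mult_partition r_sym QT) exprD mulrAC -prodrXr -big_split /=.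
rewrite [RHS]mulrCA [LHS]mulrC; congr (_ * _).
rewrite (eq_bigr (fun S : {set 'I_k} => (1 - x) ^+ #|S| * h S)) => [|S SQ]; last first.
  by apply: fS; have /and3P[_ _ /forall_inP] := thQ; apply.
by rewrite big_split prodrXr -(card_partition QT) cardsT card_ord.
Qed.
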